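(* Let $\gamma>0$ and let $X$ be, under $\mathbb{P}$, a uniformly ergodic Markov chain with time-homogeneous rate matrix $A$. Let $\tau$ be the first hitting time of a nonempty set $\Xi\subseteq\mathcal{X}$. Let $\xi$ be a random variable of the form $\xi=g(\tau,X_\tau)$ for some function $g$ with $|g(t,x)|\le k(1+t^{b})$ for some $k,b>0$. Then there exist nondecreasing functions $K,\tilde K:\mathbb{R}^+\to[1,\infty[$ and constants $\beta,\tilde\beta>0$ such that $$E^{\mathbb{Q}}[|\xi|\,|\mathcal{F}_t]\le K(t),\qquad E^{\mathbb{Q}}[(1+\tau)^{1+\beta}|\mathcal{F}_t]\le K(t),\qquad E^{\mathbb{Q}}[K(\tau)^{1+\tilde\beta}|\mathcal{F}_t]\le\tilde K(t),$$ all $\mathbb{P}$-a.s., for all $\mathbb{Q}\in\mathcal{Q}_\gamma$ and all $t$.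
   Context: Setting. Let $N\in\mathbb{N}\cup\{\infty\}$ and let $\mathcal{X}=\{e_i\}$ be the set of standard basis vectors of $\mathbb{R}^N$ ($\mathbb{R}^\infty$ is the space of real sequences). Vectors are column vectors, $z^*$ is the transpose of $z$, and $\mathbf{1}\in\mathbb{R}^N$ is the vector with all entries $1$. On $(\Omega,\mathcal{F},\mathbb{P})$, $X$ is a right-continuous pure-jump continuous-time process with values in $\mathcal{X}$ which is a Markov chain in its own filtration under $\mathbb{P}$, with (possibly infinite) rate matrix $A$; here $A_{ij}$ is the rate of jumping from $e_j$ to $e_i$, so $A_{ij}\ge0$ for $i\ne j$ and $\sum_iA_{ij}=0$ for all $j$, and the entries of $A$ are uniformly bounded. $\mathcal{F}_t$ is the completion of $\sigma(X_s:s\le t)$ by the $\mathbb{P}$-null sets of $\mathcal{F}_\infty$, and $\mathcal{F}=\mathcal{F}_\infty$. The first hitting time of $\Xi$ is $\inf\{t:X_t\in\Xi\}$. Uniform ergodicity. $X$ is uniformly ergodic if there are a probability measure $\pi$ on $\mathcal{X}$ and constants $R,\rho>0$ such that $\sup_\mu\|P^A_t\mu-\pi\|_{TV}\le Re^{-\rho t}$ for all $t$, where the supremum is over all probability measures $\mu$ on $\mathcal{X}$, $P_t^A\mu$ is the law of $X_t$ given $X_0\sim\mu$ when $X$ evolves with rate matrix $A$, and $\|f\|_{TV}=\sum_x|f(x)|$. $\mathcal{Q}_\gamma$ is the family of all probability measures $\mathbb{Q}$ under which $X$ has compensator $\lambda$ (i.e. $X_t-X_0-\int_{]0,t]}\lambda(\omega,u)\,du$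 is a $\mathbb{Q}$-martingale) for some predictable process $\lambda$ with $\mathbf{1}^*\lambda\equiv0$ and $(e_i^*\lambda(\omega,t))/(e_i^*AX_{t-})\in[\gamma,\gamma^{-1}]$ for all $i$, where $0/0:=1$.
   Formalization: The formal statement adds π(Ξ)>0: with Ξ merely nonempty the claim fails, e.g. for two states with e₁→e₂ at rate 1, e₂ absorbing, X₀=e₂ and Ξ={e₁}, where τ=∞ a.s.; the condition follows if all states communicate. *)

(* Defs.v *)
From HB Require Import structures.
From mathcomp Require Import all_boot all_order all_algebra.
From mathcomp Require Import all_classical all_reals all_analysis measurable_realfun.

Set Implicit Arguments.
Unset Strict Implicit.
Unset Printing Implicit Defensive.

Import Order.TTheory GRing.Theory Num.Theory.
Import numFieldNormedType.Exports.

Local Open Scope classical_set_scope.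
Local Open Scope ring_scope.

(* The basis vectors of R^N, e_i being represented by its index i; None is
   N = oo.  Thus e_i^* X is (X == i)%:R, and e_i^* A e_j is A i j, the rate of
   the jump from e_j to e_i. *)
Definition state (N : option nat) : countType :=
  if N is Some n then 'I_n else nat.

Section countable_state_space.
Context {R : realType} {I : countType}.

(* \esum is a sum only for nonnegative terms, hence the splitting into positive
   and negative parts. *)
Definition sums_to_zero (f : I -> R) : Prop :=
  summable setT (EFin \o f) /\
  (\esum_(i in setT) (EFin \o f)^\+ i = \esum_(i in setT) (EFin \o f)^\- i)%E.

Definition bounded_rate_matrix (A : I -> I -> R) : Prop :=
  [/\ forall i j, i != j -> 0 <= A i j,
      forall j, sums_to_zero (A ^~ j)
    & exists c, forall i j, `|A i j| <= c].

(* p t i j is the probability of being in e_i at time t when starting from e_j.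
   As A is bounded, there is exactly one such p, namely t |-> exp(tA). *)
Definition transition_function (A : I -> I -> R) (p : R -> I -> I -> R) : Prop :=
  [/\ forall t i j, 0 <= t -> 0 <= p t i j,
      forall t j, 0 <= t -> (\esum_(i in setT) (p t i j)%:E = 1)%E,
      forall i j, p 0 i j = (i == j)%:R,
      forall s t i j, 0 <= s -> 0 <= t ->
        ((p (s + t) i j)%:E = \esum_(k in setT) (p t i k * p s k j)%:E)%E
    & forall i j, (p h i j - (i == j)%:R) / h @[h --> 0^'+] --> A i j].

Definition probability_vector (mu : I -> R) : Prop :=
  (forall i, 0 <= mu i) /\ (\esum_(i in setT) (mu i)%:E = 1)%E.

Definition law_at (p : R -> I -> I -> R) (t : R) (mu : I -> R) (i : I) : R :=
  fine (\esum_(j in setT) (p t i j * mu j)%:E)%E.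

Definition tv_norm (f : I -> R) : \bar R := (\esum_(i in setT) `|f i|%:E)%E.

Definition uniformly_ergodic (p : R -> I -> I -> R) (pi : I -> R) : Prop :=
  probability_vector pi /\
  exists c rho : R, [/\ 0 < c, 0 < rho
    & forall t, 0 <= t ->
      (ereal_sup [set tv_norm (fun i => law_at p t mu i - pi i)%R
                 | mu in probability_vector] <= (c * expR (- rho * t))%:E)%E].

Context {d : measure_display} {Omega : measurableType d}.
Implicit Types (P Q : probability Omega R) (X : R -> Omega -> I).

(* The values of X at negative times are never used.  Right-continuous with
   left limits in the discrete space of states. *)
Definition pure_jump X : Prop :=
  forall w, (forall t, 0 <= t -> \forall u \near t^'+, X u w = X t w) /\
            (forall t, 0 < t -> exists j, \forall u \near t^'-, X u w = j).

Definition state_events X (T : set R) : set_system Omega :=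
  [set E | exists s (B : set I), T s /\ E = X s @^-1` B].

Definition completed P (G : set_system Omega) : set_system Omega :=
  <<s G `|` [set N | P.-negligible N] >>.

Definition filtration P X (t : R) : set_system Omega :=
  completed P (state_events X `[0, t]).

Definition filtration_oo P X : set_system Omega :=
  completed P (state_events X `[0, +oo[).

(* Z is a version of E^Q[Y | G]; meaningful for Y either nonnegative and
   measurable or Q-integrable, and G a sub-sigma-algebra. *)
Definition cond_exp_version Q (G : set_system Omega) (Y Z : Omega -> \bar R) :
    Prop :=
  (forall V : set (\bar R), measurable V -> G (Z @^-1` V)) /\
  forall B, G B -> (\int[Q]_(w in B) Z w = \int[Q]_(w in B) Y w)%E.

(* E^Q[Y | G] <= c, P-a.s.  The conditional expectation is determined only up
   to Q-null sets of G; asking for the bound Q-a.s. as well makes the condition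
   meaningful when P is not absolutely continuous with respect to Q on G. If P
   and Q have the same null sets in G, it says that every version is bounded by
   c P-a.s. *)
Definition cond_exp_le P Q (G : set_system Omega) (Y : Omega -> \bar R) (c : R) :
    Prop :=
  exists Z, [/\ cond_exp_version Q G Y Z,
                {ae P, forall w, (Z w <= c%:E)%E}
              & {ae Q, forall w, (Z w <= c%:E)%E}].

Definition markov_chain P X (p : R -> I -> I -> R) : Prop :=
  forall s t i, 0 <= s -> s <= t ->
    cond_exp_version P (filtration P X s)
      (fun w => (X t w == i)%:R%:E) (fun w => (p (t - s) i (X s w))%:E).

Definition martingale Q (F : R -> set_system Omega) (M : R -> Omega -> R) : Prop :=
  (forall t, 0 <= t -> Q.-integrable setT (EFin \o M t)) /\
  (forall s t, 0 <= s -> s <= t ->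
     cond_exp_version Q (F s) (EFin \o M t) (EFin \o M s)).

(* The predictable sigma-algebra on ]0, +oo[ x Omega (compensators do not
   involve time 0). *)
Definition predictable_sets (F : R -> set_system Omega) : set_system (R * Omega) :=
  <<s `]0, +oo[ `*` setT,
      [set E | exists s t B, [/\ 0 <= s, F s B & E = `]s, t] `*` B]] >>.

Definition predictable (F : R -> set_system Omega) (f : R -> Omega -> R) : Prop :=
  forall V : set R, measurable V ->
    predictable_sets F ((`]0, +oo[ `*` setT) `&` [set z | V (f z.1 z.2)]).

Definition has_compensator P Q X (lam : R -> Omega -> I -> R) : Prop :=
  forall i, martingale Q (filtration P X)
    (fun t w => (X t w == i)%:R - (X 0 w == i)%:R
                - \int[lebesgue_measure]_(u in `]0, t]) lam u w i).

(* a / b with 0 / 0 := 1.  In MathComp a / 0 = 0, so that for a <> 0 the value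
   of rate_ratio a 0 lies outside [gamma, gamma^-1], as it should. *)
Definition rate_ratio (a b : R) : R :=
  if (a == 0) && (b == 0) then 1 else a / b.

(* j below is the left limit of X at t. *)
Definition Qfamily P X (A : I -> I -> R) (gamma : R) (Q : probability Omega R) :
    Prop :=
  exists lam : R -> Omega -> I -> R,
  [/\ forall i, predictable (filtration P X) (fun t w => lam t w i),
      has_compensator P Q X lam,
      forall t w, 0 < t -> sums_to_zero (lam t w)
    & forall t w j, 0 < t -> (\forall u \near t^'-, X u w = j) ->
        forall i, gamma <= rate_ratio (lam t w i) (A i j) <= gamma^-1].

(* Equal to +oo on the paths which never meet Xi. *)
Definition hitting_time X (Xi : set I) (w : Omega) : \bar R :=
  ereal_inf [set t%:E | t in [set t | 0 <= t /\ Xi (X t w)]].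

End countable_state_space.

Definition at_time {R : realType} (K : R -> R) (t : \bar R) : \bar R :=
  if t is s%:E then (K s)%:E else +oo%E.

Definition nondecreasing_ge1 {R : realType} (K : R -> R) : Prop :=
  (forall s t, 0 <= s -> s <= t -> K s <= K t) /\ (forall t, 0 <= t -> 1 <= K t).

(* Main.v *)
(** Fix i0 in Xi with pi(i0) > 0. Uniform ergodicity gives t and e > 0 such that
    p_t(i0, j) >= e for every starting state j.

    Let Q be in the family and c = c0 / gamma, where c0 bounds the entries of A.
    Off the diagonal the compensator has rates at least gamma A_ij, and the
    holding rate is at most c. Hence, for B in F_s, the vector q_i(u) = Q(B, X_u
    = i) satisfies q' >= gamma A^off q - c q entrywise, whereas p' <= A^off p.
    Comparing the two, Q(B, X_(s + t/gamma) = i0) >= exp(-c t / gamma) e Q(B).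
    The comparison is made on a grid of mesh h, one step of which costs an error
    O(h^2), so no change of measure and no Fubini argument is needed.

    So Xi is hit during each time interval of length T = t/gamma with
    conditional probability at least delta, uniformly in Q and in the past. The hitting time
    after s is then dominated by T times a geometric variable, and its moments
    given F_s are bounded by polynomials in s. *)

Require Import Defs.
From HB Require Import structures.
From mathcomp Require Import all_boot all_order all_algebra.
From mathcomp Require Import all_classical all_reals all_analysis.
From mathcomp Require Import measurable_realfun.
From mathcomp Require Import ring lra.
Set Implicit Arguments.
Unset Strict Implicit.
Unset Printing Implicit Defensive.

Import Order.TTheory GRing.Theory Num.Theory.
Import numFieldNormedType.Exports.
Local Open Scope classical_set_scope.
Local Open Scope ring_scope.

(** * Sums of nonnegative families, and elementary inequalities *)

Lemma esum_ge_seq (R : realType) (I : choiceType) (x : I -> R) (J : seq I) :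
  (forall i, 0 <= x i) -> uniq J ->
  ((\sum_(i <- J) x i)%:E <= \esum_(i in setT) (x i)%:E)%E.
Proof.
move=> x0 uJ; apply: esum_ge; exists [set` J].
  by split => //; exact: finite_seq.
by rewrite -fsbig_seq// sumEFin.
Qed.

Lemma esum_approx (R : realType) (I : choiceType) (x : I -> R) (s e : R) :
  (forall i, 0 <= x i) -> 0 < e ->
  (\esum_(i in setT) (x i)%:E = s%:E)%E ->
  exists2 J : seq I, uniq J & s - e <= \sum_(i <- J) x i.
Proof.
move=> x0 e0 xs.
have fin : (\esum_(i in setT) (x i)%:E)%E \is a fin_num by rewrite xs.
have [_ [F [finF _] <-]] := ub_ereal_sup_adherent e0 fin.
rewrite -/(esum _ _) xs fsbig_finite//= sumEFin -EFinB lte_fin => /ltW xF.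
by exists (finmap.enum_fset (fset_set F)) => //; exact: finmap.fset_uniq.
Qed.

(** The terms outside [J] have total mass [1 - \sum_(i <- J) x i] and weights at most 1; the proof
    bounds the complementary sum, with weights [1 - w i], from below. This cuts Chapman-Kolmogorov
    sums down to finitely many states. *)
Lemma weighted_esum_le (R : realType) (I : choiceType) (w x : I -> R)
    (J : seq I) :
  (forall i, 0 <= x i) -> (\esum_(i in setT) (x i)%:E = 1)%E ->
  (forall i, 0 <= w i <= 1) -> uniq J ->
  (\esum_(i in setT) (w i * x i)%:E <=
   (\sum_(i <- J) w i * x i + (1 - \sum_(i <- J) x i))%:E)%E.
Proof.
move=> x0 x1 w01 uJ.
have wx0 i : 0 <= w i * x i by rewrite mulr_ge0//; case/andP: (w01 i).
have vx0 i : 0 <= (1 - w i) * x i.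
  by rewrite mulr_ge0// subr_ge0; case/andP: (w01 i).
pose a := (\esum_(i in setT) (w i * x i)%:E)%E.
pose b := (\esum_(i in setT) ((1 - w i) * x i)%:E)%E.
have ab1 : (a + b = 1)%E.
  rewrite -esumD; [|by move=> i _; rewrite lee_fin..].
  by rewrite -x1; apply: eq_esum => i _; rewrite -EFinD; congr EFin; ring.
have bJ : ((\sum_(i <- J) (1 - w i) * x i)%:E <= b)%E by exact: esum_ge_seq.
have a0 : (0 <= a)%E by apply: esum_ge0 => i _; rewrite lee_fin.
rewrite -/a; move: a b a0 bJ ab1 => [a||] [b||]//= _.
rewrite !lee_fin => vc /eqP; rewrite -EFinD eqe => /eqP ac1.
have -> : \sum_(i <- J) w i * x i =
    \sum_(i <- J) x i - \sum_(i <- J) (1 - w i) * x i.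
  by rewrite -sumrB; apply: eq_bigr => i _; ring.
lra.
Qed.

Lemma bernoulli_ineq (R : realDomainType) (x : R) n :
  x <= 1 -> 1 - n%:R * x <= (1 - x) ^+ n.
Proof.
move=> x1; elim: n => [|n IHn]; first by rewrite expr0; lra.
have [nx1|nx1] := leP (n%:R * x) 1.
  have x0 : 0 <= n%:R * x ^+ 2 by rewrite mulr_ge0// sqr_ge0.
  rewrite exprS (le_trans _ (ler_wpM2l _ IHn)) ?subr_ge0//.
  by rewrite -[n.+1]addn1 natrD; nra.
have n0 : 0 <= n%:R :> R by [].
have x0 : 0 <= x by nra.
rewrite (@le_trans _ _ 0)//; last by rewrite exprn_ge0// subr_ge0.
by rewrite -[n.+1]addn1 natrD; nra.
Qed.

Lemma cvg_sum_seq (R : realType) (I : Type) (J : seq I) (f : nat -> I -> R)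
    (l : I -> R) :
  (forall i, f ^~ i @ \oo --> l i) ->
  \sum_(i <- J) f n i @[n --> \oo] --> \sum_(i <- J) l i.
Proof.
move=> fl; elim: J => [|i J IHJ].
  by under eq_fun do rewrite big_nil; rewrite big_nil; exact: cvg_cst.
by under eq_fun do rewrite big_cons; rewrite big_cons; apply: cvgD.
Qed.

(** * Transition functions of bounded rate matrices *)

Section transition_function_bounds.
Context {R : realType} {I : countType}.
Variables (A : I -> I -> R) (p : R -> I -> I -> R) (c : R).
Hypotheses (A0 : forall i j, i != j -> 0 <= A i j)
  (As : forall j, sums_to_zero (A ^~ j))
  (Ac : forall i j, `|A i j| <= c)
  (hp : transition_function A p).

Let p_ge0 (t : R) i j : 0 <= t -> 0 <= p t i j.
Proof. by case: hp => + _ _ _ _; exact. Qed.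

Let p_sum (t : R) j : 0 <= t -> (\esum_(i in setT) (p t i j)%:E = 1)%E.
Proof. by case: hp => _ + _ _ _; exact. Qed.

Let p_add (s t : R) i j : 0 <= s -> 0 <= t ->
  ((p (s + t) i j)%:E = \esum_(k in setT) (p t i k * p s k j)%:E)%E.
Proof. by case: hp => _ _ _ + _; exact. Qed.

Lemma bound_ge0 (j : I) : 0 <= c.
Proof. exact: le_trans (normr_ge0 (A j j)) (Ac j j). Qed.

Lemma transition_le1 t i j : 0 <= t -> p t i j <= 1.
Proof.
move=> t0; rewrite -lee_fin -(p_sum j t0).
by have := @esum_ge_seq _ _ (p t ^~ j) [:: i] (fun i => p_ge0 i j t0) isT;
  rewrite big_seq1.
Qed.

Lemma transition_add_ge s t i k j : 0 <= s -> 0 <= t ->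
  p t i k * p s k j <= p (s + t) i j.
Proof.
move=> s0 t0; rewrite -lee_fin p_add//.
have := @esum_ge_seq _ _ (fun k => p t i k * p s k j) [:: k].
by rewrite big_seq1; apply => // l; rewrite mulr_ge0// p_ge0.
Qed.

Lemma transition_add_le s t i j (J : seq I) : 0 <= s -> 0 <= t -> uniq J ->
  p (s + t) i j <= \sum_(k <- J) p t i k * p s k j
    + (1 - \sum_(k <- J) p s k j).
Proof.
move=> s0 t0 uJ; rewrite -lee_fin p_add//; apply: weighted_esum_le => //.
- by move=> k; exact: p_ge0.
- exact: p_sum.
- by move=> k; rewrite p_ge0//= transition_le1.
Qed.

Lemma transition_derivative i j h : 0 < h ->
  (p (h / n.+1%:R) i j - (i == j)%:R) / (h / n.+1%:R) @[n --> \oo] --> A i j.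
Proof.
move=> h0; case: hp => _ _ _ _ /(_ i j) /cvg_at_rightP; apply; split.
  by move=> n; rewrite divr_gt0.
rewrite -[X in _ --> X](mulr0 h); apply: cvgM; first exact: cvg_cst.
exact: cvg_harmonic.
Qed.

Let offdiag j i := if i == j then 0 else A i j.

Let offdiag_ge0 j i : 0 <= offdiag j i.
Proof. by rewrite /offdiag; case: ifPn => // /A0. Qed.

Let offdiag_sum (J : seq I) j : j \notin J ->
  \sum_(i <- J) offdiag j i = \sum_(i <- J) A i j.
Proof.
move=> jJ; rewrite big_seq [RHS]big_seq; apply: eq_bigr => i iJ.
by rewrite /offdiag ifN//; apply: contraNneq jJ => <-.
Qed.

(** Only the diagonal entry of column [j] can be negative, so the sum of the negative parts is
    known, and its equality with the sum of the positive parts determines the off-diagonal sum. *)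
Lemma esum_offdiag j :
  (\esum_(i in setT) (offdiag j i)%:E = (- A j j)%:E)%E.
Proof.
case: (As j) => _.
have -> : \esum_(i in setT) (EFin \o A^~ j)^\-%E i = (Num.max (- A j j) 0)%:E.
  rewrite (esumID [set j])// ?setTI ?setICl.
  rewrite [X in (_ + X)%E]esum1; last first.
    move=> i /eqP ij; rewrite funenegE/= -EFin_max; congr EFin.
    by apply/max_idPr; rewrite oppr_le0 A0.
  by rewrite esum_set1 ?funeneg_ge0// adde0 funenegE/= -EFin_max.
have -> : \esum_(i in setT) (EFin \o A^~ j)^\+%E i =
    (\esum_(i in setT) (offdiag j i)%:E + (Num.max (A j j) 0)%:E)%E.
  have -> : (Num.max (A j j) 0)%:E = \esum_(i in setT)
      ((if i == j then Num.max (A j j) 0 else 0)%:E)%E.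
    rewrite (esumID [set j])// ?setTI ?setICl; last first.
      by move=> i _; case: ifP => //; rewrite lee_fin le_max lexx orbT.
    rewrite [X in (_ + X)%E]esum1 ?adde0; last by move=> i /eqP/negbTE ->.
    by rewrite esum_set1 eqxx// lee_fin le_max lexx orbT.
  rewrite -esumD; last 2 first.
  - by move=> i _; rewrite lee_fin.
  - by move=> i _; case: ifP => //; rewrite lee_fin le_max lexx orbT.
  apply: eq_esum => i _; rewrite funeposE/= -EFin_max -EFinD; congr EFin.
  rewrite /offdiag; case: eqP => [->|/eqP ij]; first by rewrite add0r.
  by rewrite addr0; apply/max_idPl; exact: A0.
have : (0 <= \esum_(i in setT) (offdiag j i)%:E)%E.
  by apply: esum_ge0 => i _; rewrite lee_fin.
case: (\esum_(i in setT) (offdiag j i)%:E)%E => [s||]//.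
rewrite lee_fin -EFinD => s0 [].
(* With a positive diagonal entry the positive parts would have a positive sum and the negative
   parts the sum 0. *)
have [Aj0|] := boolP (A j j <= 0); last first.
  rewrite -ltNge => Aj0.
  have -> : Num.max (A j j) 0 = A j j by apply/max_idPl; exact: ltW.
  have -> : Num.max (- A j j) 0 = 0 by apply/max_idPr; rewrite oppr_le0 ltW.
  by move=> ?; exfalso; lra.
have -> : Num.max (A j j) 0 = 0 by exact/max_idPr.
have -> : Num.max (- A j j) 0 = - A j j by apply/max_idPl; rewrite oppr_ge0.
by rewrite addr0 => ->.
Qed.

Lemma offdiag_rates_approx j (e : R) : 0 < e ->
  exists J : seq I,
    [/\ uniq J, j \notin J & - A j j - e <= \sum_(i <- J) A i j].
Proof.
move=> e0; have [J uJ] := esum_approx (offdiag_ge0 j) e0 (esum_offdiag j).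
move=> AJ; exists (rem j J); rewrite rem_uniq//; split=> //.
  by rewrite mem_rem_uniqF.
rewrite -offdiag_sum ?mem_rem_uniqF// (le_trans AJ)//.
have [jJ|jJ] := boolP (j \in J); last by rewrite rem_id.
by rewrite (big_rem j)//= {1}/offdiag eqxx add0r.
Qed.

Lemma offdiag_rates_le j (J : seq I) : uniq J -> j \notin J ->
  \sum_(i <- J) A i j <= c.
Proof.
move=> uJ jJ; rewrite -offdiag_sum//.
have := esum_ge_seq (offdiag_ge0 j) uJ.
rewrite esum_offdiag lee_fin => /le_trans; apply.
by rewrite (le_trans (ler_norm _))// normrN.
Qed.

(** Being in [j] at [n + 1] equally spaced times gives [p h j j >= (p (h / (n + 1)) j j)^(n + 1)].
    By Bernoulli this is at least [1 - (n + 1) (1 - p (h / (n + 1)) j j)], which tends to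
    [1 + h A j j]. *)
Lemma transition_diag_ge j h : 0 <= h -> 1 - c * h <= p h j j.
Proof.
rewrite le_eqVlt => /predU1P[<-|h0].
  by rewrite mulr0 subr0; case: hp => _ _ -> _ _; rewrite eqxx.
have c0 := bound_ge0 j.
have powp n t : 0 <= t -> p t j j ^+ n.+1 <= p (n.+1%:R * t) j j.
  move=> t0; elim: n => [|n IHn]; first by rewrite expr1 mul1r.
  rewrite -[n.+2]addn1 natrD mulrDl mul1r exprD expr1 addrC mulrC.
  apply: le_trans (transition_add_ge j j j t0 _); last by rewrite mulr_ge0.
  by rewrite mulrC ler_wpM2r// p_ge0.
have Dp n : 1 + h * ((p (h / n.+1%:R) j j - 1) / (h / n.+1%:R)) <= p h j j.
  have hn0 : 0 < h / n.+1%:R by rewrite divr_gt0.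
  have -> : p h j j = p (n.+1%:R * (h / n.+1%:R)) j j.
    by rewrite [n.+1%:R * _]mulrC divfK.
  apply: le_trans (powp n _ (ltW hn0)).
  have -> : 1 + h * ((p (h / n.+1%:R) j j - 1) / (h / n.+1%:R)) =
    1 + n.+1%:R * (p (h / n.+1%:R) j j - 1).
    set a := p _ _ _; have hN : h != 0 by rewrite lt0r_neq0.
    have nN : n.+1%:R != 0 :> R by [].
    congr (1 + _); rewrite invf_div mulrA mulrAC (mulrC h) divfK// mulrC//.
  have pn1 : 1 - p (h / n.+1%:R) j j <= 1.
    by rewrite gerBl p_ge0// ltW.
  have := bernoulli_ineq n.+1 pn1; rewrite opprB addrCA subrr addr0.
  by apply: le_trans; rewrite -mulrN opprB.
have cvgD : 1 + h * ((p (h / n.+1%:R) j j - (j == j)%:R) / (h / n.+1%:R))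
    @[n --> \oo] --> 1 + h * A j j.
  apply: cvgD; first exact: cvg_cst.
  by apply: cvgM; [exact: cvg_cst|exact: transition_derivative].
rewrite eqxx in cvgD.
have ub : 1 + h * A j j <= p h j j by apply: (cvgr_to_le cvgD); exact: nearW.
apply: le_trans ub; rewrite mulrC -mulrN lerD2l (ler_wpM2l (ltW h0))//.
by rewrite lerNl (le_trans (ler_norm _))// normrN.
Qed.

(** Chapman-Kolmogorov with the piece of length [h] first: after it the chain is in [j] except with
    probability at most [c h]. *)
Lemma transition_lipschitz t h i j : 0 <= t -> 0 <= h ->
  p (t + h) i j <= p t i j + c * h.
Proof.
move=> t0 h0; rewrite addrC.
rewrite (le_trans (transition_add_le i j h0 t0 (J := [:: j]) _))//.
rewrite !big_seq1 lerD ?ler_piMr ?p_ge0 ?transition_le1//.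
by rewrite lerBlDr -lerBlDl transition_diag_ge.
Qed.

Lemma transition_lower t h i j : 0 <= t -> 0 <= h ->
  p t i j - c * h <= p (t + h) i j.
Proof.
move=> t0 h0; rewrite [t + h]addrC.
rewrite (le_trans _ (transition_add_ge i j j h0 t0))//.
have := transition_diag_ge j h0; have := transition_le1 i j t0.
have := p_ge0 i j t0; have := bound_ge0 j; have := transition_le1 j j h0.
by move=> *; nra.
Qed.

(** During a first piece of length [e] the chain stays in [j], moves to [J], or goes elsewhere,
    which is the last term. For the moves to [J], replacing [t + h] by [t] costs [c h], weighted by
    a total probability at most [c e]. *)
Lemma transition_increment (t e h : R) i j (J : seq I) :
    0 <= t -> 0 <= h -> 0 <= e -> uniq J -> j \notin J ->
  p (t + h + e) i j - p (t + h) i j <=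
  \sum_(k <- J) p t i k * p e k j + c * h * (c * e)
  + (1 - p e j j - \sum_(k <- J) p e k j).
Proof.
move=> t0 h0 e0 uJ jJ.
have th0 : 0 <= t + h by rewrite addr_ge0.
have uj : uniq (j :: J) by rewrite /= jJ uJ.
have := transition_add_le i j e0 th0 uj.
rewrite (addrC e) !big_cons.
have : \sum_(k <- J) p (t + h) i k * p e k j <=
       \sum_(k <- J) p t i k * p e k j + c * h * \sum_(k <- J) p e k j.
  rewrite mulr_sumr -big_split/=; apply: ler_sum => k _; rewrite -mulrDl.
  by rewrite ler_wpM2r ?p_ge0// transition_lipschitz.
have Jle : \sum_(k <- J) p e k j + p e j j <= 1.
  rewrite -lee_fin -(p_sum j e0).
  have := @esum_ge_seq _ _ (p e ^~ j) (j :: J) (fun i => p_ge0 i j e0) uj.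
  by rewrite big_cons addrC.
have := transition_diag_ge j e0.
have : p (t + h) i j * p e j j <= p (t + h) i j.
  by rewrite ler_piMr ?p_ge0 ?transition_le1.
have ch0 : 0 <= c * h by rewrite mulr_ge0// (bound_ge0 j).
move=> H1 H2 H3 H4.
have : c * h * \sum_(k <- J) p e k j <= c * h * (c * e).
  by rewrite ler_wpM2l//; lra.
lra.
Qed.

(* The rates are given only as pointwise derivatives at 0: the increment over h
   is cut into n + 1 pieces, and n tends to infinity. Restricting to a finite J
   avoids any interchange of this limit with a sum over the states. *)
Lemma transition_step_le (t h e : R) i j : 0 <= t -> 0 <= h -> 0 < e ->
  exists J : seq I, [/\ uniq J, j \notin J &
    p (t + h) i j <= p t i j + h * \sum_(k <- J) p t i k * A k j
      + (c * h) ^+ 2 + h * e].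
Proof.
move=> t0; rewrite le_eqVlt => /predU1P[<- _|h0 e0].
  by exists [::]; split => //;
    rewrite big_nil addr0 !mul0r !mulr0 !addr0 expr0n/= addr0.
have [J [uJ jJ AJ]] := offdiag_rates_approx j e0.
exists J; split => //.
pose q n k := (p (h / n.+1%:R) k j - (k == j)%:R) / (h / n.+1%:R).
pose u n : R := p t i j + h * (\sum_(k <- J) p t i k * q n k
  - q n j - \sum_(k <- J) q n k) + (c * h) ^+ 2.
have qP k : q ^~ k @ \oo --> A k j by exact: transition_derivative.
have uP : u n @[n --> \oo] --> p t i j + h * (\sum_(k <- J) p t i k * A k j
    - A j j - \sum_(k <- J) A k j) + (c * h) ^+ 2.
  apply: cvgD; last exact: cvg_cst.
  apply: cvgD; first exact: cvg_cst.
  apply: cvgM; first exact: cvg_cst.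
  apply: cvgB; last by apply: cvg_sum_seq => k; exact: qP.
  apply: cvgB; last exact: qP.
  apply: cvg_sum_seq => k.
  by apply: cvgM; [exact: cvg_cst|exact: qP].
have le_u n : p (t + h) i j <= u n.
  pose d := h / n.+1%:R.
  have d0 : 0 < d by rewrite divr_gt0.
  have qE k : k != j -> p d k j = d * q n k.
    by move=> /negbTE kj; rewrite /q kj subr0 mulrC divfK// lt0r_neq0.
  have qjE : p d j j = d * q n j + 1.
    by rewrite /q eqxx [d * _]mulrC divfK ?lt0r_neq0// subrK.
  have sumqE (w : I -> R) : \sum_(k <- J) w k * p d k j =
    d * \sum_(k <- J) w k * q n k.
    rewrite mulr_sumr big_seq [RHS]big_seq; apply: eq_bigr => k kJ.
    by rewrite qE; [ring|apply: contraNneq jJ => <-].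
  have sumq1 : \sum_(k <- J) p d k j = d * \sum_(k <- J) q n k.
    have /= := sumqE (fun=> 1); under eq_bigr do rewrite mul1r.
    by move=> ->; congr (_ * _); apply: eq_bigr => k _; rewrite mul1r.
  pose S := \sum_(k <- J) p t i k * q n k - q n j - \sum_(k <- J) q n k.
  (* Piece [m] starts at [t + m d] with [m d <= h], so its error is at most [d c^2 h]; the [n + 1]
     errors add up to [(c h)^2]. *)
  have step m : (m <= n)%N -> p (t + m.+1%:R * d) i j - p (t + m%:R * d) i j <=
      d * S + d * (c ^+ 2 * h).
    move=> mn; have md0 : 0 <= m%:R * d by rewrite mulr_ge0// ltW.
    have := transition_increment i t0 md0 (ltW d0) uJ jJ.
    have <- : t + m%:R * d + d = t + m.+1%:R * d by rewrite -natr1; ring.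
    move/le_trans; apply.
    rewrite sumqE sumq1 qjE.
    have mdh : m%:R * d <= h.
      by rewrite /d mulrCA (ler_piMr (ltW h0))// ler_pdivrMr// mul1r ler_nat
        leqW.
    have : d * c ^+ 2 * (m%:R * d) <= d * c ^+ 2 * h.
      by rewrite ler_wpM2l// mulr_ge0 ?sqr_ge0// ltW.
    rewrite /S; lra.
  have : p (t + n.+1%:R * d) i j - p (t + 0%:R * d) i j <=
      \sum_(0 <= m < n.+1) (d * S + d * (c ^+ 2 * h)).
    rewrite -(telescope_sumr (fun m => p (t + m%:R * d) i j))// !big_nat.
    by apply: ler_sum => m /andP[_ mn]; rewrite step.
  rewrite mul0r addr0 big_const_nat subn0 iter_addr_0.
  have ndh : n.+1%:R * d = h by rewrite /d mulrC divfK.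
  rewrite ndh -mulrDr -mulrnAl -[d *+ _]mulr_natl ndh /u -/S; lra.
have ub : p (t + h) i j <= p t i j +
    h * (\sum_(k <- J) p t i k * A k j - A j j - \sum_(k <- J) A k j)
    + (c * h) ^+ 2.
  by apply: (cvgr_to_ge uP); exact: nearW.
(* The remaining defect [- A j j - \sum_(k <- J) A k j] is at most [e] by the choice of [J]. *)
apply: le_trans ub _.
rewrite -lerBlDl; have := ltW h0 => /(ler_wpM2l); move: AJ; nra.
Qed.

End transition_function_bounds.

(** * Minorization from uniform ergodicity *)

Lemma esum_delta (R : realType) (I : choiceType) (f : I -> R) (j : I) :
  0 <= f j -> (\esum_(i in setT) (f i * (i == j)%:R)%:E = (f j)%:E)%E.
Proof.
move=> fj0.
have F0 i : (0 <= (f i * (i == j)%:R)%:E)%E.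
  by rewrite lee_fin; case: eqP => [->|_]; rewrite ?mulr1 ?mulr0.
rewrite (esumID [set j])// setTI setTI [X in (_ + X)%E]esum1; last first.
  by move=> i /eqP/negbTE ->; rewrite mulr0.
by rewrite adde0 esum_set1// eqxx mulr1.
Qed.

Lemma exp_decay_small (R : realType) (c rho e : R) :
  0 < c -> 0 < rho -> 0 < e ->
  exists2 t, 0 < t & c * expR (- rho * t) <= e.
Proof.
(* As [expR x >= 1 + x], it suffices that [c <= e (1 + rho t)]; the witness makes [e rho t = c]. *)
move=> c0 rho0 e0; exists (c / (rho * e)); first by rewrite divr_gt0// mulr_gt0.
rewrite mulNr expRN ler_pdivrMr ?expR_gt0//.
apply: (@le_trans _ _ (e * (1 + rho * (c / (rho * e))))).
  rewrite mulrDr mulr1.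
  have -> : e * (rho * (c / (rho * e))) = c.
    by field; rewrite !lt0r_neq0.
  by rewrite lerDr ltW.
by rewrite ler_wpM2l ?expR_ge1Dx// ltW.
Qed.

(** Uniform ergodicity is applied to the point mass at each starting state. Total variation controls
    the single coordinate [i0], and at a time when it is at most [pi i0 / 2], that much probability
    is left at [i0], uniformly in [j]. *)
Lemma uniformly_ergodic_minorized (R : realType) (I : countType)
    (A : I -> I -> R) (p : R -> I -> I -> R) (pi : I -> R) (Xi : set I) :
  transition_function A p -> uniformly_ergodic p pi ->
  (0 < \esum_(i in Xi) (pi i)%:E)%E ->
  exists i0 t e, [/\ Xi i0, 0 < t, 0 < e & forall j, e <= p t i0 j].
Proof.
move=> [p0 p1 _ _ _] [[pi0 _] [c [rho [c0 rho0 cvp]]]] piXi.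
have [i0 Xi0 pii0] : exists2 i, Xi i & 0 < pi i.
  apply: contrapT => piN; move: piXi; rewrite esum1 ?ltxx// => i Xii.
  congr EFin; apply/eqP; rewrite eq_le pi0 andbT leNgt.
  by apply/negP => pii; apply: piN; exists i.
have hp0 : 0 < pi i0 / 2 by rewrite divr_gt0.
have [t t0 ct] := exp_decay_small c0 rho0 hp0.
exists i0, t, (pi i0 / 2); split => // j.
pose mu (k : I) : R := (k == j)%:R.
have muP : probability_vector mu.
  split=> [k|]; first exact: ler0n.
  by rewrite -(@esum_delta _ _ (fun=> 1) j)//; apply: eq_esum => k _;
    rewrite mul1r.
have lawE i : law_at p t mu i = p t i j.
  by rewrite /law_at esum_delta// p0// ltW.
have tvle : (tv_norm (fun i => law_at p t mu i - pi i)%R <=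
    (c * expR (- rho * t))%:E)%E.
  by apply: le_trans (cvp t (ltW t0)); apply: ereal_sup_ubound; exists mu.
have : (`|p t i0 j - pi i0|%:E <= (c * expR (- rho * t))%:E)%E.
  apply: le_trans tvle; rewrite /tv_norm -lawE.
  have := @esum_ge_seq _ _ (fun i => `|law_at p t mu i - pi i|) [:: i0].
  by rewrite big_seq1; apply.
rewrite lee_fin distrC => /(le_trans (ler_norm _)); lra.
Qed.

(** * The filtration of the chain *)

Section filtration_theory.
Context {R : realType} {I : countType} {d : measure_display}
  {Omega : measurableType d}.
Variables (P : probability Omega R) (X : R -> Omega -> I).

Local Notation F := (filtration P X).

Lemma filtration_le s t : s <= t -> F s `<=` F t.
Proof.
move=> st; apply: sub_sigma_algebra2; apply: setSU => E [u [B [su ->]]].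
exists u, B; split => //; move: su; rewrite /= !in_itv/= => /andP[-> us].
exact: le_trans us st.
Qed.

Lemma filtration_sub t : F t `<=` filtration_oo P X.
Proof.
apply: sub_sigma_algebra2; apply: setSU => E [u [B [su ->]]].
by exists u, B; split => //; move: su; rewrite /= !in_itv/= andbT => /andP[].
Qed.

Lemma filtration_state t (B : set I) : 0 <= t -> F t (X t @^-1` B).
Proof.
move=> t0; apply: sub_sigma_algebra; left; exists t, B; split => //=.
by rewrite in_itv/= t0 lexx.
Qed.

Lemma filtrationI t B C : F t B -> F t C -> F t (B `&` C).
Proof. exact: (@measurableI _ (g_sigma_algebraType _)). Qed.

Lemma filtrationD t B C : F t B -> F t C -> F t (B `\` C).
Proof. exact: (@measurableD _ (g_sigma_algebraType _)). Qed.

(** The sets whose section at [w] is measurable form a sigma-algebra containing the generating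
    rectangles. This makes the pathwise integrals of the compensator meaningful. *)
Lemma predictable_section (f : R -> Omega -> R) w : predictable F f ->
  measurable_fun (`]0, +oo[ : set R) (fun u => f u w).
Proof.
move=> pf _ V /pf; set E := (X in predictable_sets _ X -> _).
suff H : predictable_sets F `<=` [set E | measurable [set u | E (u, w)]].
  move=> /H /=; congr (measurable _); apply/seteqP; split => u /=.
    by move=> [[]].
  by move=> [].
apply: smallest_sub; last first.
  move=> C [s [t [B [_ _ ->]]]] /=.
  have [Bw|Bw] := pselect (B w).
    rewrite [X in measurable X](_ : _ = `]s, t]%classic)//.
    by apply/seteqP; split => u /= => [[]|].
  rewrite [X in measurable X](_ : _ = set0)//.
  by apply/seteqP; split => u /= => [[]|].
split => /=.
- by rewrite [X in measurable X](_ : _ = set0).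
- move=> C mC; rewrite [X in measurable X](_ : _ =
    `]0, +oo[%classic `\` [set u | C (u, w)]); first exact: measurableD.
  by apply/seteqP; split => u /=; [move=> [[]]|move=> []].
- move=> C mC; rewrite [X in measurable X](_ : _ =
    \bigcup_k [set u | C k (u, w)]); first exact: bigcup_measurable.
  by apply/seteqP; split => u.
Qed.

End filtration_theory.

(** * Rate ratios and integrals of finite sums *)

Lemma rate_ratio_bounds (R : realType) (gamma a b : R) : 0 < gamma ->
  gamma <= rate_ratio a b <= gamma^-1 ->
  `|a| <= gamma^-1 * `|b| /\ (0 <= b -> gamma * b <= a).
Proof.
move=> g0; rewrite /rate_ratio; case: ifPn => [/andP[/eqP -> /eqP ->] _|].
  by rewrite normr0 !mulr0.
have [->|b0 _] := eqVneq b 0; first by rewrite invr0 mulr0 (lt_geF g0).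
move=> /andP[lo up]; split => [|b_ge0].
  have : `|a / b| <= gamma^-1 by rewrite ger0_norm// (le_trans _ lo)// ltW.
  by rewrite normrM normfV ler_pdivrMr ?normr_gt0.
by move: lo; rewrite ler_pdivlMr// lt0r b0.
Qed.

Lemma Rintegral_sum_seq d (T : measurableType d) (R : realType)
    (mu : {measure set T -> \bar R}) (D : set T) (I : Type) (J : seq I)
    (f : I -> T -> R) :
  measurable D -> (forall i, mu.-integrable D (EFin \o f i)) ->
  mu.-integrable D (EFin \o (fun x => \sum_(i <- J) f i x)) /\
  \int[mu]_(x in D) (\sum_(i <- J) f i x) =
  \sum_(i <- J) \int[mu]_(x in D) f i x.
Proof.
move=> mD intf; elim: J => [|i J [intJ IHJ]].
  under eq_Rintegral do rewrite big_nil.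
  rewrite big_nil Rintegral_cst// mul0r; split => //.
  by under [X in _.-integrable _ X]funext => x do rewrite /= big_nil;
    exact: integrable0.
have eqf : (fun x => \sum_(k <- i :: J) f k x) =
  (fun x => f i x + \sum_(k <- J) f k x).
  by apply/funext => x; rewrite big_cons.
rewrite eqf big_cons -IHJ RintegralD//; split => //.
exact: (integrableD mD (intf i) intJ).
Qed.

Lemma integrable_EFinZl d (T : measurableType d) (R : realType)
    (mu : {measure set T -> \bar R}) (D : set T) (k : R) (f : T -> R) :
  measurable D -> mu.-integrable D (EFin \o f) ->
  mu.-integrable D (EFin \o (fun x => k * f x)).
Proof.
move=> mD intf; rewrite (_ : EFin \o _ = (fun x => k%:E * (EFin \o f) x)%E).
  exact: integrableZl.
by apply/funext => x; rewrite /= EFinM.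
Qed.

(** * Hitting probabilities under the measures of the family *)

Definition prob {R : realType} {d : measure_display} {Omega : measurableType d}
  (Q : probability Omega R) (E : set Omega) : R := fine (Q E).

Lemma prob_setID (R : realType) (d : measure_display) (Omega : measurableType d)
    (Q : probability Omega R) (E C : set Omega) :
  measurable E -> measurable C ->
  prob Q E = prob Q (E `&` C) + prob Q (E `\` C).
Proof.
move=> mE mC; rewrite /prob -fineD ?fin_num_measure//; last 2 first.
- exact: measurableI.
- exact: measurableD.
by rewrite addeC -measureDI.
Qed.

Definition at_state {T Omega I : Type} (X : T -> Omega -> I) (t : T) (i : I) :
  set Omega := X t @^-1` [set i].

Definition rate_integral {R : realType} {I Omega : Type}
    (lam : R -> Omega -> I -> R) (i : I) (s t : R) (w : Omega) : R :=
  \int[lebesgue_measure]_(u in `]s, t]) lam u w i.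

(** Right-continuity at [u] speaks of times to its right, hence a grid point strictly beyond [u].
    The mesh is smaller than [e], and than [s + h - u] so that this point does not pass the end of
    the grid. *)
Lemma dyadic_between (R : realType) (s u h e : R) :
  s <= u -> u < s + h -> 0 < e ->
  exists m k, (k <= 2 ^ m)%N /\ u < s + k%:R * (h / 2 ^+ m) < u + e.
Proof.
move=> su ush e0; have h0 : 0 < h by lra.
pose m := (Num.truncn (h / Num.min e (s + h - u))).+1.
have e'0 : 0 < Num.min e (s + h - u) by rewrite lt_min e0 /= subr_gt0.
have pm0 : 0 < 2 ^+ m :> R by rewrite exprn_gt0.
have hm : h / 2 ^+ m < Num.min e (s + h - u).
  rewrite ltr_pdivrMr// mulrC -ltr_pdivrMr//.
  apply: (@lt_trans _ _ m%:R); last by rewrite -natrX ltr_nat ltn_expl.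
  have h1 : 0 <= h / Num.min e (s + h - u) by rewrite divr_ge0// ltW.
  by have /andP[] := truncn_itv h1.
have d0 : 0 < h / 2 ^+ m by rewrite divr_gt0.
set dl := h / 2 ^+ m in hm d0 *.
have us0 : 0 <= (u - s) / dl by rewrite divr_ge0 ?subr_ge0// ltW.
have /andP[] := truncn_itv us0; set k := Num.truncn _.
rewrite ler_pdivlMr// ltr_pdivrMr// => lo up.
have kd : k.+1%:R * dl = k%:R * dl + dl by rewrite -natr1; ring.
move: hm; rewrite lt_min => /andP[de dh].
rewrite kd in up.
exists m, k.+1; rewrite -/dl; split; last by rewrite kd; apply/andP; split; lra.
rewrite -(ler_nat R) natrX -(ler_pM2r d0).
have -> : 2 ^+ m * dl = h by rewrite /dl mulrC divfK// lt0r_neq0.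
by rewrite kd; lra.
Qed.

Section compensated_chain.
Context {R : realType} {I : countType} {d : measure_display}
  {Omega : measurableType d}.
Variables (P Q : probability Omega R) (X : R -> Omega -> I) (A : I -> I -> R)
  (lam : R -> Omega -> I -> R) (gamma c0 : R).
Hypotheses (hF : @measurable d Omega = filtration_oo P X)
  (hX : pure_jump X)
  (A0 : forall i j, i != j -> 0 <= A i j)
  (Ac : forall i j, `|A i j| <= c0)
  (Aoff : forall j (J : seq I), uniq J -> j \notin J ->
    \sum_(i <- J) A i j <= c0)
  (gamma0 : 0 < gamma)
  (lam_pred : forall i, predictable (filtration P X) (fun t w => lam t w i))
  (lam_comp : has_compensator P Q X lam)
  (lam_rate : forall t w j, 0 < t -> (\forall u \near t^'-, X u w = j) ->
     forall i, gamma <= rate_ratio (lam t w i) (A i j) <= gamma^-1).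

Local Notation F := (filtration P X).
Local Notation mu := (@lebesgue_measure R).
(** Bound on the rates of the compensator, hence on the rate of leaving a state under [Q];
    [gamma c = c0]. *)
Let c := gamma^-1 * c0.
Local Notation pr := (prob Q).
Local Notation at_ := (at_state X).
Local Notation Lam := (rate_integral lam).

Let c_ge0 : 0 <= c.
Proof.
have w : Omega by exact: point.
rewrite mulr_ge0 ?invr_ge0 ?(ltW gamma0)//.
exact: le_trans (normr_ge0 _) (Ac (X 0 w) (X 0 w)).
Qed.

Let mF t B : F t B -> measurable B.
Proof. by rewrite hF; exact: filtration_sub. Qed.

Let m_at t i : 0 <= t -> measurable (at_ t i).
Proof. by move=> t0; apply: mF; exact: filtration_state t0. Qed.

Let prE (E : set Omega) : measurable E -> Q E = (pr E)%:E.
Proof. by move=> mE; rewrite /prob fineK// fin_num_measure. Qed.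

Let pr_ge0 E : 0 <= pr E. Proof. exact: fine_ge0. Qed.

Let pr_le (B C : set Omega) : measurable B -> measurable C -> B `<=` C ->
  pr B <= pr C.
Proof. by move=> mB mC BC; rewrite -lee_fin -!prE// le_measure ?inE. Qed.

Let lam_bound u w i : 0 < u -> `|lam u w i| <= c.
Proof.
move=> u0; have [_ /(_ u u0)[j Xj]] := hX w.
have [+ _] := rate_ratio_bounds gamma0 (lam_rate u0 Xj i).
by move/le_trans; apply; rewrite /c ler_wpM2l// invr_ge0 ltW.
Qed.

Let lam_offdiag u w i j : 0 < u -> (\forall u' \near u^'-, X u' w = j) ->
  i != j -> gamma * A i j <= lam u w i.
Proof.
move=> u0 Xj ij; have [_] := rate_ratio_bounds gamma0 (lam_rate u0 Xj i).
by apply; exact: A0.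
Qed.

Let lam_int i s t w : 0 <= s ->
  mu.-integrable `]s, t] (EFin \o (fun u => lam u w i)).
Proof.
move=> s0; apply: measurable_bounded_integrable => //.
- by rewrite /= lebesgue_measure_itv/=; case: ifP => _;
    rewrite ?ltry// -EFinB ltry.
- have := predictable_section w (lam_pred i).
  apply: measurable_funS => // u /=; rewrite !in_itv/= andbT => /andP[su _].
  exact: le_lt_trans su.
- exists c; split; first exact: num_real.
  move=> x cx u /=; rewrite in_itv/= => /andP[su _].
  by rewrite (le_trans (lam_bound _ _ _)) ?(ltW cx)// (le_lt_trans s0).
Qed.

Let Lam_add i s t w : 0 <= s -> s <= t ->
  Lam i 0 t w - Lam i 0 s w = Lam i s t w.
Proof.
move=> s0 st; rewrite /rate_integral Rintegral_itvB//; exact: lam_int.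
Qed.

Let indE t i w : (X t w == i)%:R = \1_(at_ t i) w :> R.
Proof.
rewrite indicE; congr (_ %:R); congr nat_of_bool.
by apply/eqP/idP; rewrite inE.
Qed.

Let ind_int B t i : measurable B -> 0 <= t ->
  Q.-integrable B (EFin \o (fun w => (X t w == i)%:R)).
Proof.
move=> mB t0.
rewrite (_ : (fun w => _) = \1_(at_ t i)).
  by apply: (@integrableS _ _ _ _ setT) => //; apply: integrable_indic;
    exact: m_at.
by apply/funext => w; rewrite indE.
Qed.

Let Rint_ind B t i : measurable B -> 0 <= t ->
  \int[Q]_(w in B) (X t w == i)%:R = pr (B `&` at_ t i).
Proof.
move=> mB t0; under eq_Rintegral do rewrite indE.
by rewrite /Rintegral integral_indic//; [rewrite setIC|exact: m_at].
Qed.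

(** The martingale increment between [s] and [t] integrates to 0 over an event of the past at [s].
    As [Lam] is a combination of indicators and of the martingale, its integrability follows as
    well. *)
Lemma rate_integral_increment B i s t : 0 <= s -> s <= t -> F s B ->
  Q.-integrable B (EFin \o Lam i s t) /\
  \int[Q]_(w in B) Lam i s t w = pr (B `&` at_ t i) - pr (B `&` at_ s i).
Proof.
move=> s0 st FB; have mB := mF FB; have t0 := le_trans s0 st.
pose M t w : R := (X t w == i)%:R - (X 0 w == i)%:R - Lam i 0 t w.
have [intM /(_ s t s0 st)[_ /(_ B FB) EM]] : martingale Q F M := lam_comp i.
have ME u w : M u w = (X u w == i)%:R - (X 0 w == i)%:R - Lam i 0 u w by [].
clearbody M.
have intMB u : 0 <= u -> Q.-integrable B (EFin \o M u).
  by move=> u0; exact: (integrableS measurableT mB (@subsetT _ B) (intM u u0)).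
have LamE : Lam i s t =
    fun w => ((X t w == i)%:R - (X s w == i)%:R) - (M t w - M s w).
  apply/funext => w; rewrite -(Lam_add i w s0 st) !ME.
  move: (_ == _)%:R (_ == _)%:R (_ == _)%:R (Lam i 0 t w) (Lam i 0 s w).
  by move=> x y z u v; ring.
have int1 : Q.-integrable B
    (EFin \o (fun w => (X t w == i)%:R - (X s w == i)%:R)).
  exact: (integrableB mB (ind_int i mB t0) (ind_int i mB s0)).
have int2 : Q.-integrable B (EFin \o (fun w => M t w - M s w)).
  exact: (integrableB mB (intMB _ t0) (intMB _ s0)).
split; first by rewrite LamE; exact: (integrableB mB int1 int2).
rewrite LamE (RintegralB mB int1 int2).
rewrite (RintegralB mB (ind_int i mB t0) (ind_int i mB s0)).
rewrite (RintegralB mB (intMB t t0) (intMB s s0)).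
rewrite (Rint_ind i mB t0) (Rint_ind i mB s0).
suff -> : \int[Q]_(w in B) M t w = \int[Q]_(w in B) M s w.
  by rewrite subrr subr0.
by rewrite /Rintegral; congr fine; rewrite -EM.
Qed.

Lemma rate_integral_ge (J : seq I) (f : I -> R) s t w a : 0 <= s -> s <= t ->
  (forall u, s < u <= t -> a <= \sum_(i <- J) f i * lam u w i) ->
  a * (t - s) <= \sum_(i <- J) f i * Lam i s t w.
Proof.
move=> s0 st le_a.
have intf i : mu.-integrable `]s, t] (EFin \o (fun u => f i * lam u w i)).
  by apply: integrable_EFinZl => //; exact: lam_int.
have mI : measurable (`]s, t] : set (measurableTypeR R)) by [].
have [intS ES] := @Rintegral_sum_seq _ _ _ mu _ _ J _ mI intf.
have -> : \sum_(i <- J) f i * Lam i s t w =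
    \int[mu]_(u in `]s, t]) (\sum_(i <- J) f i * lam u w i).
  by rewrite ES; apply: eq_bigr => i _; rewrite RintegralZl//; exact: lam_int.
have -> : a * (t - s) = \int[mu]_(u in `]s, t]) a.
  rewrite Rintegral_cst//= lebesgue_measure_itv/= lte_fin.
  case: ltP => [_|ts]; first by rewrite -EFinB.
  by have -> : t = s by [apply/eqP; rewrite eq_le ts st]; rewrite subrr.
apply: le_Rintegral => //; apply: measurable_bounded_integrable => //.
  by rewrite /= lebesgue_measure_itv/=; case: ifP => _;
    rewrite ?ltry// -EFinB ltry.
by exists `|a|; split => // x ax u _ /=; exact: ltW.
Qed.

Lemma weighted_rate_integral_increment B J (f : I -> R) s t : 0 <= s ->
  s <= t -> F s B ->
  Q.-integrable B (EFin \o (fun w => \sum_(i <- J) f i * Lam i s t w)) /\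
  \int[Q]_(w in B) (\sum_(i <- J) f i * Lam i s t w) =
  \sum_(i <- J) f i * (pr (B `&` at_ t i) - pr (B `&` at_ s i)).
Proof.
move=> s0 st FB; have mB := mF FB.
have intf i : Q.-integrable B (EFin \o (fun w => f i * Lam i s t w)).
  exact: (integrable_EFinZl (f i) mB (rate_integral_increment i s0 st FB).1).
have [intS ->] := Rintegral_sum_seq J mB intf; split => //.
apply: eq_bigr => i _; have [intL <-] := rate_integral_increment i s0 st FB.
exact: RintegralZl.
Qed.

(** The rate of [j] never falls below [- c]. Only the single time [t] is considered: the path may
    have left [j] and returned. *)
Lemma staying_prob_ge B j s t : 0 <= s -> s <= t -> F s B -> B `<=` at_ s j ->
  (1 - c * (t - s)) * pr B <= pr (B `&` at_ t j).
Proof.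
move=> s0 st FB Bj; have mB := mF FB.
have [intS ES] := weighted_rate_integral_increment [:: j] (fun=> 1) s0 st FB.
have : - c * (t - s) * pr B <=
  \int[Q]_(w in B) (\sum_(i <- [:: j]) 1 * Lam i s t w).
  rewrite /prob -Rintegral_cst//; apply: le_Rintegral => //.
    apply: measurable_bounded_integrable => //.
      by rewrite -ge0_fin_numE// fin_num_measure.
    by exists `|- c * (t - s)|; split => // x ax u _ /=; exact: ltW.
  move=> w _; apply: rate_integral_ge => // u /andP[su _].
  rewrite big_seq1 mul1r; have := lam_bound w j (le_lt_trans s0 su).
  by rewrite ler_norml => /andP[].
rewrite ES big_seq1 mul1r (_ : B `&` at_ s j = B); last exact/setIidPl.
lra.
Qed.

Let stay s j e n : set Omega :=
  [set w | forall k, (k <= n)%N -> X (s + k%:R * e) w = j].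

(** Having stayed at the earlier grid times is itself an event of the past, so the bound for one
    step applies to it again. *)
Lemma staying_grid_prob_ge B j s e n : 0 <= s -> 0 <= e -> c * e <= 1 ->
  F s B -> B `<=` at_ s j ->
  F (s + n%:R * e) (B `&` stay s j e n) /\
  (1 - c * e) ^+ n * pr B <= pr (B `&` stay s j e n).
Proof.
move=> s0 e0 ce1 FB Bj; elim: n => [|n [IHF IHn]].
  have -> : B `&` stay s j e 0 = B.
    apply/setIidPl => w /Bj Xj k; rewrite leqn0 => /eqP ->.
    by rewrite mul0r addr0.
  by rewrite mul0r addr0 expr0 mul1r; split.
have ne0 : 0 <= s + n%:R * e by rewrite addr_ge0// mulr_ge0.
have se : s + n%:R * e <= s + n.+1%:R * e by rewrite lerD2l ler_wpM2r// ler_nat.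
have -> : B `&` stay s j e n.+1 =
  (B `&` stay s j e n) `&` at_ (s + n.+1%:R * e) j.
  apply/seteqP; split => w.
    move=> [Bw Sw]; split; last exact: Sw.
    by split => // k kn; apply: Sw; exact: leqW.
  move=> [[Bw Sw] Sn]; split => // k; rewrite leq_eqVlt => /predU1P[->//|].
  exact: Sw.
split.
  apply: filtrationI; first exact: filtration_le IHF.
  by apply: filtration_state; exact: le_trans se.
have Sj : B `&` stay s j e n `<=` at_ (s + n%:R * e) j by move=> w [_]; apply.
have := staying_prob_ge ne0 se IHF Sj.
have -> : s + n.+1%:R * e - (s + n%:R * e) = e by rewrite -natr1; ring.
apply: le_trans; rewrite exprS -mulrA ler_wpM2l// subr_ge0//.
Qed.

(* By right-continuity these paths stay in j on the whole of [s, s + h[. *)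
Let never_left s j h : set Omega :=
  [set w | forall m k, (k <= 2 ^ m)%N -> X (s + k%:R * (h / 2 ^+ m)) w = j].

Lemma never_leftE s j h :
  never_left s j h = \bigcap_m stay s j (h / 2 ^+ m) (2 ^ m).
Proof.
apply/seteqP; split => w Sw m; first by move=> _; exact: Sw.
exact: (Sw m Logic.I).
Qed.

(** The dyadic grids are nested, so the events decrease and their probabilities converge to that of
    the intersection; by Bernoulli, [(1 - c h / 2^m)^(2^m) >= 1 - c h] for every [m]. *)
Lemma never_left_prob_ge B j s h : 0 <= s -> 0 <= h -> c * h <= 1 -> F s B ->
  B `<=` at_ s j ->
  measurable (B `&` never_left s j h) /\
  (1 - c * h) * pr B <= pr (B `&` never_left s j h).
Proof.
move=> s0 h0 ch1 FB Bj.
pose D m := B `&` stay s j (h / 2 ^+ m) (2 ^ m).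
have pow2 m : 0 < 2 ^+ m :> R by rewrite exprn_gt0.
have hm0 m : 0 <= h / 2 ^+ m by rewrite divr_ge0// ltW.
have chm m : c * (h / 2 ^+ m) <= 1.
  rewrite mulrA ler_pdivrMr// mul1r (le_trans ch1)// exprn_ege1// ler1n//.
have DP m := staying_grid_prob_ge (2 ^ m) s0 (hm0 m) (chm m) FB Bj.
have mD m : measurable (D m) by exact: mF (DP m).1.
have DE : B `&` never_left s j h = \bigcap_m D m.
  by rewrite never_leftE -bigcapIr//; exists 0%N.
have mcap : measurable (\bigcap_m D m) by exact: bigcap_measurable.
have D_decr : {homo D : n m / (n <= m)%N >-> (m <= n)%O}.
  move=> n m nm; apply/subsetPset => w [Bw Sw]; split => // k kn.
  have -> : k%:R * (h / 2 ^+ n) = (k * 2 ^ (m - n))%:R * (h / 2 ^+ m) :> R.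
    have -> : 2 ^+ m = 2 ^+ (m - n) * 2 ^+ n :> R by rewrite -exprD subnK.
    by rewrite natrM natrX; field; rewrite !expf_neq0.
  by apply: Sw; rewrite -{2}(subnKC nm) expnD leq_mul2r kn orbT.
rewrite DE; split=> //.
have cvD : (Q \o D @ \oo --> Q (\bigcap_m D m))%classic.
  by apply: nonincreasing_cvg_mu => //; rewrite -ge0_fin_numE// fin_num_measure.
rewrite -lee_fin -prE//; apply: (cvge_to_ge cvD); apply: nearW => m /=.
rewrite prE// lee_fin; apply: le_trans (DP m).2; rewrite ler_wpM2r//.
apply: le_trans (bernoulli_ineq _ (chm m)); rewrite lerD2l lerN2.
by rewrite natrX mulrCA [2 ^+ m * _]mulrC divfK// lt0r_neq0.
Qed.

(** Every [v] in [[s, u[] has dyadic grid points arbitrarily close to its right, where the path is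
    in [j]. Left limits are what controls the rates at [u], including [u = s + h]. *)
Lemma never_left_left_limit s j h u w : 0 <= s -> s < u <= s + h ->
  never_left s j h w -> \forall v \near u^'-, X v w = j.
Proof.
move=> s0 /andP[su ush] Sw.
suff H v : s <= v -> v < u -> X v w = j.
  exists (u - s) => /=; first by rewrite subr_gt0.
  move=> v /= uv vu; apply: H => //.
  by move: uv; rewrite ltr_norml => /andP[_]; lra.
move=> sv vu; have v0 := le_trans s0 sv.
have [e /= e0 He] := (hX w).1 v v0.
have [m [k [km /andP[lo up]]]] := dyadic_between sv (lt_le_trans vu ush) e0.
rewrite -(Sw m k km); apply/esym/He => //=.
by rewrite ltr_norml; apply/andP; split; lra.
Qed.

Lemma sum_prob_at_state_le E t (J : seq I) : 0 <= t -> measurable E -> uniq J ->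
  \sum_(i <- J) pr (E `&` at_ t i) <= pr E.
Proof.
move=> t0; elim: J E => [|i J IHJ] E mE; first by rewrite big_nil.
move=> /= /andP[iJ uJ]; rewrite big_cons.
have mi := m_at i t0.
rewrite (prob_setID Q mE mi) lerD2l; apply: le_trans (IHJ _ _ uJ);
  last exact: measurableD.
rewrite big_seq [leRHS]big_seq; apply: ler_sum => k kJ.
rewrite (_ : (E `\` _) `&` _ = E `&` at_ t k)//.
apply/seteqP; split => w; first by move=> [[]].
move=> [Ew Xk]; split => //; split => // Xi; move: iJ kJ.
by rewrite -Xi -Xk => /negP.
Qed.

Lemma sum_ge_but_one (J : seq I) (x : I -> R) j a : uniq J -> 0 <= a ->
  (forall i, i != j -> 0 <= x i) -> - a <= x j -> - a <= \sum_(i <- J) x i.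
Proof.
move=> uJ a0 x0 xj; have [jJ|jJ] := boolP (j \in J).
  rewrite (big_rem j)//= -[- a]addr0 lerD// big_seq sumr_ge0// => i.
  by rewrite mem_rem_uniq// inE => /andP[ij _]; exact: x0.
rewrite (@le_trans _ _ 0)// ?oppr_le0// big_seq sumr_ge0// => i iJ.
by apply: x0; apply: contraNneq jJ => <-.
Qed.

(* On paths staying in j the rates towards J are at least gamma A_ij; on the
   others, which have probability at most c h Q(B), at most one lam_i is
   negative at any time, so that the weighted sum of the rates is at least -c. *)
Lemma jump_prob_ge B j s h (J : seq I) (f : I -> R) : 0 <= s -> 0 <= h ->
  c * h <= 1 -> F s B -> B `<=` at_ s j -> uniq J -> j \notin J ->
  (forall i, 0 <= f i <= 1) ->
  (gamma * h * \sum_(i <- J) f i * A i j - (c0 ^+ 2 + c ^+ 2) * h ^+ 2) * pr B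
  <= \sum_(i <- J) f i * pr (B `&` at_ (s + h) i).
Proof.
move=> s0 h0 ch1 FB Bj uJ jJ f01; have mB := mF FB.
have st : s <= s + h by rewrite lerDl.
have [intS ES] := weighted_rate_integral_increment J f s0 st FB.
have [mS SB] := never_left_prob_ge s0 h0 ch1 FB Bj.
set S := B `&` never_left s j h in mS SB.
have -> : \sum_(i <- J) f i * pr (B `&` at_ (s + h) i) =
  \int[Q]_(w in B) (\sum_(i <- J) f i * Lam i s (s + h) w).
  rewrite ES big_seq [RHS]big_seq; apply: eq_bigr => i iJ.
  rewrite (_ : B `&` at_ s i = set0); first by rewrite /prob measure0 subr0.
  apply/seteqP; split => w //= -[Bw Xi].
  by move: jJ; rewrite -(Bj _ Bw : X s w = j) (Xi : X s w = i) iJ.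
pose a := gamma * \sum_(i <- J) f i * A i j.
have Sf0 : 0 <= \sum_(i <- J) f i * A i j.
  rewrite big_seq sumr_ge0// => i iJ; have /andP[f0 _] := f01 i.
  by rewrite mulr_ge0// A0//; apply: contraNneq jJ => <-.
have Sf1 : \sum_(i <- J) f i * A i j <= c0.
  apply: le_trans (Aoff uJ jJ); rewrite big_seq [leRHS]big_seq.
  apply: ler_sum => i iJ; have /andP[_ f1] := f01 i.
  by rewrite ler_piMl// A0//; apply: contraNneq jJ => <-.
(* The left-hand side is [a h] on [S] and [- c h] off [S]. *)
have lower w : B w -> (a + c) * h * \1_S w - c * h <=
    \sum_(i <- J) f i * Lam i s (s + h) w.
  move=> Bw; have ge_avg := @rate_integral_ge J f s (s + h) w _ s0 st.
  have sh : s + h - s = h by ring.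
  have [Sw|Sw] := pselect (S w).
    rewrite indicE mem_set// mulr1 -mulrBl addrK -{1}sh; apply: ge_avg => u su.
    rewrite /a mulr_sumr big_seq [leRHS]big_seq; apply: ler_sum => i iJ.
    have /andP[f0 _] := f01 i; rewrite mulrCA ler_wpM2l//.
    have u0 : 0 < u by case/andP: su => /(le_lt_trans s0).
    apply: lam_offdiag => //; first exact: never_left_left_limit s0 su Sw.2.
    by apply: contraNneq jJ => <-.
  rewrite indicE memNset// mulr0 add0r -mulNr -{1}sh; apply: ge_avg => u su.
  have u0 : 0 < u by case/andP: su => /(le_lt_trans s0).
  have [_ /(_ u u0)[j' Xj']] := hX w.
  have lamj i : - c <= lam u w i.
    by have := lam_bound w i u0; rewrite ler_norml => /andP[].
  apply: (@sum_ge_but_one _ _ j') => //.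
    move=> i ij; have /andP[f0 _] := f01 i; rewrite mulr_ge0//.
    apply: le_trans (lam_offdiag u0 Xj' ij).
    by rewrite mulr_ge0 ?(ltW gamma0)// A0.
  have /andP[fj0 fj1] := f01 j'; have := lamj j'; have := c_ge0; nra.
have int_low : Q.-integrable B
    (EFin \o (fun w => (a + c) * h * \1_S w - c * h)).
  apply: measurable_bounded_integrable => //.
    by rewrite -ge0_fin_numE// fin_num_measure.
    by apply: measurable_funB => //; apply: measurable_funM => //;
      exact: measurable_indic.
  exists (`|(a + c) * h| + `|c * h|); split => // x ax w _ /=;
    apply: le_trans (ltW ax).
  rewrite (le_trans (ler_normB _ _))// lerD2r normrM ler_piMr// indicE.
  by case: (_ \in _); rewrite ?normr1 ?normr0.
have := le_Rintegral mB int_low intS lower.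
apply: le_trans.
have indS : Q.-integrable B (EFin \o (\1_S : Omega -> R)).
  by apply: (@integrableS _ _ _ _ setT) => //; exact: integrable_indic.
rewrite RintegralB//; last 2 first.
- exact: integrable_EFinZl.
- apply: measurable_bounded_integrable => //;
    first by rewrite -ge0_fin_numE// fin_num_measure.
  by exists `|c * h|; split => // x ax u _ /=; exact: ltW.
rewrite RintegralZl// Rintegral_cst// /Rintegral integral_indic//.
rewrite (_ : S `&` B = S); last by apply/setIidPl => w [].
rewrite -/(pr S) -/(pr B).
have a0 : 0 <= a by rewrite mulr_ge0// ltW.
have ac : a <= gamma * c0 by rewrite ler_wpM2l// ltW.
have gc : gamma * c = c0 by rewrite /c mulrA divff ?mul1r// lt0r_neq0.
(* The integrated lower bound has coefficient [(a + c) h (1 - c h) - c h = a h - (a c + c^2) h^2],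
   and [a c <= gamma c0 c = c0^2]. *)
have : (a + c) * h * ((1 - c * h) * pr B) <= (a + c) * h * pr S.
  by rewrite ler_wpM2l// mulr_ge0// addr_ge0.
have : a * (c * h ^+ 2) * pr B <= gamma * c0 * (c * h ^+ 2) * pr B.
  by rewrite ler_wpM2r ?ler_wpM2r// mulr_ge0// sqr_ge0.
rewrite (_ : gamma * c0 * (c * h ^+ 2) = c0 ^+ 2 * h ^+ 2); last first.
  by have -> : c0 ^+ 2 = c0 * (gamma * c) by [rewrite gc expr2]; ring.
rewrite /a; lra.
Qed.

(* One backward step of the grid: the hypothesis on f at n steps from the target
   gives the analogous bound for g at n + 1 steps. The four terms multiplying
   h^2 come from jump_prob_ge (two), from f j <= g j + c0 gamma h (using
   gamma c = c0), and from the defect D of the recursion for g. *)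
Lemma hitting_prob_step (f g : I -> R) i0 n (r eps D : R) s h B j
    (J : seq I) :
  0 <= s -> 0 <= h -> c * h <= 1 -> 0 <= r <= 1 -> 0 <= eps -> 0 <= D ->
  (forall i, 0 <= f i <= 1) ->
  (forall s' B' i, 0 <= s' -> F s' B' -> B' `<=` at_ s' i ->
     (r * f i - eps) * pr B' <= pr (B' `&` at_ (s' + n%:R * h) i0)) ->
  uniq J -> j \notin J ->
  g j <= f j + gamma * h * \sum_(i <- J) f i * A i j + D * h ^+ 2 ->
  f j - c0 * (gamma * h) <= g j ->
  F s B -> B `<=` at_ s j ->
  ((1 - c * h) * r * g j
   - (eps + (c0 ^+ 2 + c ^+ 2 + c0 ^+ 2 + D) * h ^+ 2)) * pr B
  <= pr (B `&` at_ (s + n.+1%:R * h) i0).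
Proof.
move=> s0 h0 ch1 /andP[r0 r1] eps0 D0 f01 hit uJ jJ gle gge FB Bj.
have mB := mF FB; have sh0 : 0 <= s + h by rewrite addr_ge0.
have -> : s + n.+1%:R * h = s + h + n%:R * h by rewrite -natr1; ring.
have uj : uniq (j :: J) by rewrite /= jJ.
have nh0 : 0 <= s + h + n%:R * h by rewrite addr_ge0// mulr_ge0.
have mE : measurable (B `&` at_ (s + h + n%:R * h) i0).
  by apply: measurableI => //; exact: m_at.
(* Only the paths that are in [j] or in [J] at time [s + h] are counted; on each of these disjoint
   events the bound at [n] steps applies. *)
apply: le_trans (sum_prob_at_state_le sh0 mE uj).
have FBh i : F (s + h) (B `&` at_ (s + h) i).
  apply: filtrationI; first by apply: filtration_le FB; rewrite lerDl.
  exact: filtration_state.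
have le1 : \sum_(i <- j :: J) (r * f i - eps) * pr (B `&` at_ (s + h) i) <=
  \sum_(i <- j :: J) pr (B `&` at_ (s + h + n%:R * h) i0 `&` at_ (s + h) i).
  apply: ler_sum => i _; rewrite setIAC; exact: hit.
apply: le_trans le1.
have -> : \sum_(i <- j :: J) (r * f i - eps) * pr (B `&` at_ (s + h) i) =
  r * \sum_(i <- j :: J) f i * pr (B `&` at_ (s + h) i)
  - eps * \sum_(i <- j :: J) pr (B `&` at_ (s + h) i).
  by rewrite !mulr_sumr -sumrB; apply: eq_bigr => i _; ring.
have epsle : eps * \sum_(i <- j :: J) pr (B `&` at_ (s + h) i) <= eps * pr B.
  by rewrite ler_wpM2l// sum_prob_at_state_le.
have sh : s <= s + h by rewrite lerDl.
have jump := jump_prob_ge s0 h0 ch1 FB Bj uJ jJ f01.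
have := staying_prob_ge s0 sh FB Bj.
rewrite (_ : s + h - s = h); last by ring.
move=> stayj; rewrite big_cons.
have gc : gamma * c = c0 by rewrite /c mulrA divff ?mul1r// lt0r_neq0.
have /andP[fj0 fj1] := f01 j.
move: epsle jump stayj gle gge.
set SP := \sum_(i <- J) f i * pr _; set SA := \sum_(i <- J) f i * A i j.
set SE := \sum_(i <- j :: J) _; set q := pr (B `&` _).
move: (pr_ge0 B); set b := pr B => b0 epsle jump stayj gle gge.
have fq : f j * ((1 - c * h) * b) <= f j * q by rewrite ler_wpM2l.
(* In [(1 - c h) g j = g j - c h g j], the upper bound on [g j] is used for the first term and the
   lower bound for the second. *)
have key : ((1 - c * h) * g j - (c0 ^+ 2 + c ^+ 2 + c0 ^+ 2 + D) * h ^+ 2) * b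
  <= f j * q + SP.
  apply: (@le_trans _ _ (f j * ((1 - c * h) * b) +
     (gamma * h * SA - (c0 ^+ 2 + c ^+ 2) * h ^+ 2) * b)); last by rewrite lerD.
  rewrite (mulrA (f j)) -mulrDl ler_wpM2r//.
  have : c * h * (f j - c0 * (gamma * h)) <= c * h * g j.
    by rewrite ler_wpM2l// mulr_ge0.
  have -> : c * h * (f j - c0 * (gamma * h)) = c * h * f j - c0 ^+ 2 * h ^+ 2.
    by rewrite -gc; ring.
  lra.
have : r * (((1 - c * h) * g j - (c0 ^+ 2 + c ^+ 2 + c0 ^+ 2 + D) * h ^+ 2) * b)
   <= r * (f j * q + SP) by rewrite ler_wpM2l.
have : r * ((c0 ^+ 2 + c ^+ 2 + c0 ^+ 2 + D) * h ^+ 2 * b) <=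
   (c0 ^+ 2 + c ^+ 2 + c0 ^+ 2 + D) * h ^+ 2 * b.
  by rewrite ler_piMl// !mulr_ge0 ?addr_ge0 ?sqr_ge0.
lra.
Qed.

(** Induction on the number of steps to the target, for all times, past events and starting states
    at once. Each step costs a factor [1 - c h] and an error of order [h^2]; the errors merely add
    up, the factors being at most 1. *)
Lemma hitting_prob_iter (f : nat -> I -> R) i0 (D h : R) : 0 <= h ->
  c * h <= 1 -> 0 <= D ->
  (forall n i, 0 <= f n i <= 1) ->
  (forall i, f 0%N i = (i0 == i)%:R) ->
  (forall n j, f n j - c0 * (gamma * h) <= f n.+1 j) ->
  (forall n j, exists J : seq I, [/\ uniq J, j \notin J &
     f n.+1 j <=
     f n j + gamma * h * \sum_(i <- J) f n i * A i j + D * h ^+ 2]) ->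
  forall n s B j, 0 <= s -> F s B -> B `<=` at_ s j ->
  ((1 - c * h) ^+ n * f n j
   - n%:R * ((c0 ^+ 2 + c ^+ 2 + c0 ^+ 2 + D) * h ^+ 2)) * pr B
  <= pr (B `&` at_ (s + n%:R * h) i0).
Proof.
move=> h0 ch1 D0 f01 f0 fge fle; elim=> [|n IHn] s B j s0 FB Bj.
  rewrite expr0 !mul0r subr0 mul1r addr0 f0; have [ij|_] := eqVneq i0 j.
    by rewrite ij mul1r (_ : B `&` _ = B)//; apply/setIidPl.
  by rewrite mul0r.
have [J [uJ jJ fJ]] := fle n j.
have r01 : 0 <= (1 - c * h) ^+ n <= 1.
  rewrite exprn_ge0 ?subr_ge0//= exprn_ile1 ?subr_ge0//.
  by rewrite gerBl mulr_ge0.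
have eps0 : 0 <= n%:R * ((c0 ^+ 2 + c ^+ 2 + c0 ^+ 2 + D) * h ^+ 2).
  by rewrite !mulr_ge0 ?addr_ge0 ?sqr_ge0.
set K := _ * h ^+ 2.
have -> : n.+1%:R * K = n%:R * K + K by rewrite -natr1; ring.
rewrite exprS.
exact: (hitting_prob_step s0 h0 ch1 r01 eps0 D0 (f01 n) IHn uJ jJ fJ (fge n j)
  FB Bj).
Qed.

(** The event is cut according to the state at time [s]. States are added one at a time in the order
    of their codes, and continuity of the measure from below takes all of them into account. *)
Lemma hitting_prob_ge_of_states i0 s T (del : R) B : 0 <= s -> 0 <= T ->
  0 <= del -> F s B ->
  (forall j B', F s B' -> B' `<=` at_ s j ->
    del * pr B' <= pr (B' `&` at_ (s + T) i0)) ->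
  del * pr B <= pr (B `&` at_ (s + T) i0).
Proof.
move=> s0 T0 del0 FB hit; have sT0 : 0 <= s + T by rewrite addr_ge0.
pose N n := X s @^-1` [set i | (pickle i < n)%N].
have FN n : F s (N n) by exact: filtration_state.
have FBN n : F s (B `&` N n) by exact: filtrationI.
have mBN n := mF (FBN n); have m0 := m_at i0 sT0.
have HN n : del * pr (B `&` N n) <= pr (B `&` N n `&` at_ (s + T) i0).
  elim: n => [|n IHn].
    by rewrite (_ : B `&` N 0%N = set0) ?set0I /prob ?measure0 ?mulr0//;
      apply/seteqP; split => w // [].
  have mNn := mF (FN n).
  have NN : B `&` N n.+1 `&` N n = B `&` N n.
    by rewrite -setIA; congr (_ `&` _); apply/setIidPr => w; exact: leqW.
  rewrite (prob_setID Q (mBN n.+1) mNn) mulrDr.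
  have mE : measurable (B `&` N n.+1 `&` at_ (s + T) i0) by exact: measurableI.
  rewrite (prob_setID Q mE mNn); apply: lerD.
    by rewrite NN (setIAC (B `&` N n.+1)) NN.
  rewrite [X in _ <= pr X]setDE (setIAC (B `&` N n.+1)) -setDE.
  have [[j jn]|nj] := pselect (exists j : I, pickle j = n).
    apply: hit; first exact: filtrationD.
    move=> w [[_]] /=; rewrite /N /= ltnS leq_eqVlt => /predU1P[Xn _|//].
    by apply: (pcan_inj (@pickleK I)); exact: etrans Xn (esym jn).
  rewrite (_ : B `&` N n.+1 `\` N n = set0);
    first by rewrite set0I /prob measure0 mulr0.
  apply/seteqP; split => w // [[_]] /=;
    rewrite /N /= ltnS leq_eqVlt => /predU1P[Xn _|//].
  by apply: nj; exists (X s w).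
have cvN : (Q \o (fun n => B `&` N n) @ \oo --> Q B)%classic.
  have {2}-> : B = \bigcup_n (B `&` N n).
    apply/seteqP; split => w; last by move=> [n _ []].
    by move=> Bw; exists (pickle (X s w)).+1 => //; split => //; exact: ltnSn.
  apply: nondecreasing_cvg_mu => //; first exact: bigcup_measurable.
  by move=> n m nm; apply/subsetPset => w [Bw Nw]; split => //;
    exact: leq_trans Nw nm.
have cvN' : pr (B `&` N n) @[n --> \oo] --> pr B.
  by apply: fine_cvg; rewrite /prob fineK ?fin_num_measure//; exact: mF FB.
have cvdel : del * pr (B `&` N n) @[n --> \oo] --> del * pr B.
  by apply: cvgM => //; exact: cvg_cst.
apply: (cvgr_to_le cvdel); apply: nearW => n.
apply: le_trans (HN n) (pr_le _ _ _).
- exact: measurableI.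
- by apply: measurableI => //; exact: mF FB.
- by move=> w [[]].
Qed.

Lemma hitting_prob_ge (f : nat -> I -> R) i0 (D h e T : R) n : 0 <= h ->
  c * h <= 1 -> 0 <= D ->
  (forall n i, 0 <= f n i <= 1) ->
  (forall i, f 0%N i = (i0 == i)%:R) ->
  (forall n j, f n j - c0 * (gamma * h) <= f n.+1 j) ->
  (forall n j, exists J : seq I, [/\ uniq J, j \notin J &
     f n.+1 j <=
     f n j + gamma * h * \sum_(i <- J) f n i * A i j + D * h ^+ 2]) ->
  T = n%:R * h ->
  (forall j, e <= (1 - c * h) ^+ n * f n j
    - n%:R * ((c0 ^+ 2 + c ^+ 2 + c0 ^+ 2 + D) * h ^+ 2)) ->
  0 <= e ->
  forall s B, 0 <= s -> F s B ->
  e * pr B <= pr (B `&` at_ (s + T) i0).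
Proof.
move=> h0 ch1 D0 f01 f0 fge fle TE le_e e0 s B s0 FB.
have T0 : 0 <= T by rewrite TE mulr_ge0.
apply: hitting_prob_ge_of_states => // j B' FB' Bj; rewrite TE.
apply: le_trans (hitting_prob_iter h0 ch1 D0 f01 f0 fge fle n s0 FB' Bj).
by rewrite ler_wpM2r.
Qed.

End compensated_chain.

(** * Hitting probability uniform over the family *)

Lemma discretization_fine_enough (R : realType) (K L e : R) :
  0 <= K -> 0 <= L -> 0 < e ->
  exists n (del : R), [/\ (0 < n)%N, 0 < del, K / n%:R <= 1 &
    del <= (1 - K / n%:R) ^+ n * e - L / n%:R].
Proof.
move=> K0 L0 e0.
(* The grid has [n = n0 k] steps. As [K / n0 <= 1/2], Bernoulli with exponent [k] gives
   [(1 - K / n)^k >= 1/2], hence [(1 - K / n)^n >= 2^-n0] whatever [k] is. Then [k] is taken so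
   large that [L / n <= q], and [2 q - q = q] remains. *)
pose n0 := (Num.truncn (2 * K)).+1; pose q : R := 2^-1 ^+ n0 * e / 2.
have q0 : 0 < q by rewrite divr_gt0// mulr_gt0// exprn_gt0// invr_gt0.
pose k := (Num.truncn (L / q)).+1.
have Kn0 : K / n0%:R <= 2^-1.
  rewrite ler_pdivrMr// mulrC ler_pdivlMr// mulrC ltW//.
  by have /andP[] := @truncn_itv _ (2 * K) (mulr_ge0 (ler0n _ _) K0).
have Lk : L / k%:R <= q.
  rewrite ler_pdivrMr// mulrC -ler_pdivrMr// ltW//.
  by have /andP[] := @truncn_itv _ (L / q) (divr_ge0 L0 (ltW q0)).
have n0_ge1 : 1 <= n0%:R :> R by rewrite ler1n.
have k_ge1 : 1 <= k%:R :> R by rewrite ler1n.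
have Kn1 : K / (n0 * k)%:R <= K / n0%:R.
  by rewrite ler_wpM2l// lef_pV2 ?posrE ?ltr0n// ler_nat leq_pmulr.
have Ln1 : L / (n0 * k)%:R <= L / k%:R.
  by rewrite ler_wpM2l// lef_pV2 ?posrE ?ltr0n// ler_nat leq_pmull.
exists (n0 * k)%N, q; split => //; first by lra.
have le1 : K / (n0 * k)%:R <= 1 by lra.
have := bernoulli_ineq k le1.
have -> : k%:R * (K / (n0 * k)%:R) = K / n0%:R.
  by rewrite natrM; field; rewrite !pnatr_eq0.
move=> lek.
have : 2^-1 ^+ n0 <= (1 - K / (n0 * k)%:R) ^+ (n0 * k).
  rewrite [X in _ <= _ ^+ X]mulnC exprM; apply: lerXn2r.
  - by rewrite nnegrE; lra.
  - by rewrite nnegrE exprn_ge0// subr_ge0.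
  - by apply: le_trans lek; lra.
move=> /(ler_wpM2r (ltW e0)).
have -> : 2^-1 ^+ n0 * e = 2 * q by rewrite /q; field.
by move=> ?; lra.
Qed.

(** The grid, [T] and [del] are fixed before [Q], from [c0], [gamma], [t] and [e] only; hence the
    uniformity over the family. *)
Lemma uniform_hitting_prob (R : realType) (I : countType) (d : measure_display)
    (Omega : measurableType d) (P : probability Omega R) (X : R -> Omega -> I)
    (A : I -> I -> R) (p : R -> I -> I -> R) (gamma t e : R) (i0 : I) :
  @measurable d Omega = filtration_oo P X -> pure_jump X ->
  bounded_rate_matrix A -> transition_function A p ->
  0 < gamma -> 0 < t -> 0 < e -> (forall j, e <= p t i0 j) ->
  exists T del : R, [/\ 0 < T, 0 < del &
    forall Q : probability Omega R, Qfamily P X A gamma Q ->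
    forall s B, 0 <= s -> filtration P X s B ->
    del * prob Q B <= prob Q (B `&` at_state X (s + T) i0)].
Proof.
move=> hF hX [A0 As [c0 Ac]] hp g0 t0 e0 pe.
have c00 : 0 <= c0 := bound_ge0 Ac i0.
pose c := gamma^-1 * c0; pose T := t / gamma.
(* [D h^2] is the error of a step of [p] over the time [gamma h] with tolerance [h], namely
   [(c0 gamma h)^2 + (gamma h) h]. [C] is the resulting constant for one step of the comparison. *)
pose D := (c0 * gamma) ^+ 2 + gamma.
pose C := c0 ^+ 2 + c ^+ 2 + c0 ^+ 2 + D.
have T0 : 0 < T by rewrite divr_gt0.
have c_ge0 : 0 <= c by rewrite mulr_ge0// invr_ge0 ltW.
have D0 : 0 <= D by rewrite addr_ge0 ?sqr_ge0// ltW.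
have C0 : 0 <= C by have := sqr_ge0 c0; have := sqr_ge0 c; rewrite /C; lra.
have cT0 : 0 <= c * T by rewrite mulr_ge0// ltW.
have CT0 : 0 <= C * T ^+ 2 by rewrite mulr_ge0// sqr_ge0.
have [n [del [n0 del0 cTn delle]]] := discretization_fine_enough cT0 CT0 e0.
have nN0 : n%:R != 0 :> R by rewrite pnatr_eq0 -lt0n.
exists T, del; split => // Q [lam [lam_pred lam_comp _ lam_rate]] s B s0 FB.
(* While X advances by h, p advances by gamma h only, because the rates under Q
   are only known to be at least gamma A. *)
pose h := T / n%:R; pose f m j := p (m%:R * (gamma * h)) i0 j.
have h0 : 0 < h by rewrite divr_gt0// ltr0n.
have gh0 : 0 <= gamma * h by rewrite mulr_ge0// ltW.
have mgh m : 0 <= m%:R * (gamma * h) by rewrite mulr_ge0.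
have fS m j : f m.+1 j = p (m%:R * (gamma * h) + gamma * h) i0 j.
  by rewrite /f; congr (p _ i0 j); rewrite -natr1; ring.
apply: (@hitting_prob_ge _ _ _ _ P Q X A lam gamma c0 hF hX A0 Ac
  (offdiag_rates_le A0 As Ac) g0 lam_pred lam_comp lam_rate f i0 D h del T n
  (ltW h0)) => //.
- by rewrite -/c /h mulrA.
- move=> m j; rewrite /f (transition_le1 hp)// andbT.
  by case: hp => + _ _ _ _; apply.
- by move=> j; rewrite /f mul0r; case: hp => _ _ -> _ _.
- by move=> m j; rewrite fS; exact: (transition_lower Ac hp i0 j (mgh m) gh0).
- move=> m j; rewrite fS.
  have [J [uJ jJ le_J]] := transition_step_le A0 As Ac hp i0 j (mgh m) gh0 h0.
  exists J; split => //; apply: le_trans le_J _.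
  rewrite -!addrA lerD2l lerD2l /D.
  by rewrite le_eqVlt; apply/orP; left; apply/eqP; ring.
- by rewrite /h; field.
- move=> j; apply: le_trans delle _.
  have fn : f n j = p t i0 j.
    by rewrite /f /h /T; congr (p _ i0 j); field; rewrite nN0 lt0r_neq0.
  rewrite fn -/c -/C (_ : c * h = c * T / n%:R); last by rewrite /h mulrA.
  rewrite lerB//; first by rewrite ler_wpM2l// exprn_ge0// subr_ge0.
  by rewrite le_eqVlt; apply/orP; left; apply/eqP; rewrite /h; field.
- exact: ltW.
Qed.

(** * Moments of the hitting time *)

Lemma sum_poly_geometric_bounded (R : realType) (T del : R) (m : nat) :
  0 < T -> 0 < del <= 1 ->
  exists2 C, 1 <= C & forall N,
    \sum_(0 <= n < N) (1 + n.+1%:R * T) ^+ m * (1 - del) ^+ n <= C.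
Proof.
move=> T0 /andP[del0 del1].
(* Choosing eps with m eps T <= del / 2 gives (1 + x T)^m <= eps^-m e^(x del/2),
   whereas (1 - del)^n <= e^(- n del). *)
pose a := del / 2; have a0 : 0 < a by rewrite divr_gt0.
pose eps := Num.min 1 (a / (m.+1%:R * T)).
have eps0 : 0 < eps by rewrite lt_min ltr01 divr_gt0// mulr_gt0.
have eps1 : eps <= 1 by rewrite ge_min lexx.
have mepsT : m%:R * (eps * T) <= a.
  have : eps <= a / (m.+1%:R * T) by rewrite ge_min lexx orbT.
  rewrite ler_pdivlMr ?mulr_gt0// => /(le_trans _); apply.
  rewrite mulrCA ler_wpM2l ?(ltW eps0)// ler_wpM2r ?(ltW T0)// ler_nat//.
pose q := expR (- a).
have q0 : 0 < q by exact: expR_gt0.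
have q1 : q < 1 by rewrite expR_lt1 oppr_lt0.
pose K := eps^-1 ^+ m * expR a.
have K0 : 0 < K by rewrite mulr_gt0 ?expR_gt0// exprn_gt0// invr_gt0.
have term n : (1 + n.+1%:R * T) ^+ m * (1 - del) ^+ n <= K * q ^+ n.
  have x0 : 0 <= n.+1%:R * T by rewrite mulr_ge0// ltW.
  have le1 : 1 + n.+1%:R * T <= eps^-1 * expR (n.+1%:R * (eps * T)).
    rewrite ler_pdivlMl// (le_trans _ (expR_ge1Dx _))//.
    by rewrite mulrDr mulr1 (mulrCA eps) lerD2r.
  have le2 : (1 + n.+1%:R * T) ^+ m <= eps^-1 ^+ m * expR (a * n.+1%:R).
    apply: (@le_trans _ _ ((eps^-1 * expR (n.+1%:R * (eps * T))) ^+ m)).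
      by apply: lerXn2r => //; rewrite nnegrE;
        [lra|rewrite mulr_ge0 ?expR_ge0// invr_ge0 ltW].
    rewrite exprMn ler_wpM2l ?exprn_ge0 ?invr_ge0 ?(ltW eps0)//.
    by rewrite -expRM_natl ler_expR mulrCA mulrC ler_wpM2r.
  have le3 : (1 - del) ^+ n <= expR (- del * n%:R).
    rewrite mulrC expRM_natl; apply: lerXn2r;
      rewrite ?nnegrE ?subr_ge0 ?expR_ge0//.
    exact: expR_ge1Dx.
  have -> : K * q ^+ n = eps^-1 ^+ m * expR (a * n.+1%:R) * expR (- del * n%:R).
    rewrite /K /q -expRM_natl -!mulrA -!expRD; congr (_ * expR _).
    by rewrite -natr1 /a; field.
  by apply: ler_pM => //; rewrite exprn_ge0// ?subr_ge0//; lra.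
exists (Num.max 1 (K / (1 - q))); first by rewrite le_max lexx.
move=> N; rewrite le_max; apply/orP; right.
have q10 : 0 < 1 - q by lra.
(* The exact partial sum of the geometric series makes the induction on [N] close. *)
suff : \sum_(0 <= n < N) (1 + n.+1%:R * T) ^+ m * (1 - del) ^+ n <=
  K / (1 - q) * (1 - q ^+ N).
  move/le_trans; apply; rewrite ler_piMr ?divr_ge0 ?(ltW K0) ?(ltW q10)//.
  by rewrite gerBl exprn_ge0// ltW.
elim: N => [|N IHN]; first by rewrite big_nil expr0 subrr mulr0.
rewrite big_nat_recr//= (le_trans (lerD IHN (term N)))// exprS.
by rewrite le_eqVlt; apply/orP; left; apply/eqP; field; rewrite lt0r_neq0.
Qed.

Section hitting_moments.
Context {R : realType} {I : countType} {d : measure_display}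
  {Omega : measurableType d}.
Variables (P Q : probability Omega R) (X : R -> Omega -> I) (Xi : set I)
  (i0 : I) (T del C : R) (m : nat).
Hypotheses (hF : @measurable d Omega = filtration_oo P X) (Xi0 : Xi i0)
  (T0 : 0 < T) (del1 : 0 <= 1 - del)
  (hit : forall s B, 0 <= s -> filtration P X s B ->
    del * prob Q B <= prob Q (B `&` at_state X (s + T) i0))
  (C0 : forall N,
    \sum_(0 <= n < N) (1 + n.+1%:R * T) ^+ m * (1 - del) ^+ n <= C).

Let missed s n : set Omega :=
  [set w | forall k, (k < n)%N -> X (s + k.+1%:R * T) w != i0].

(** Each new miss is considered given the earlier ones, an event of the past at [s + n T], and costs
    a factor [1 - del]. *)
Lemma missed_prob_le s n B : 0 <= s -> filtration P X s B ->
  filtration P X (s + n%:R * T) (B `&` missed s n) /\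
  prob Q (B `&` missed s n) <= (1 - del) ^+ n * prob Q B.
Proof.
move=> s0 FB; have mF t E : filtration P X t E -> measurable E.
  by rewrite hF; exact: filtration_sub.
elim: n => [|n [IHF IHn]].
  have -> : B `&` missed s 0 = B by apply/setIidPl => w _ k.
  by rewrite mul0r addr0 expr0 mul1r.
have ts0 : 0 <= s + n%:R * T by rewrite addr_ge0// mulr_ge0// ltW.
have tE : s + n.+1%:R * T = s + n%:R * T + T by rewrite -natr1; ring.
have -> : B `&` missed s n.+1 =
    (B `&` missed s n) `\` at_state X (s + n.+1%:R * T) i0.
  apply/seteqP; split => w.
    move=> [Bw Mw]; split; last by move=> /eqP; apply/negP/Mw.
    by split => // k kn; apply: Mw; exact: ltnW.
  move=> [[Bw Mw] Nw]; split => // k; rewrite ltnS leq_eqVlt => /predU1P[->|].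
    exact/eqP.
  exact: Mw.
have tn : s + n%:R * T <= s + n.+1%:R * T by rewrite tE lerDl ltW.
have Fat : filtration P X (s + n.+1%:R * T) (at_state X (s + n.+1%:R * T) i0).
  by apply: filtration_state; exact: le_trans tn.
split; first by apply: filtrationD => //; exact: filtration_le IHF.
have := hit ts0 IHF; rewrite -tE => hitn.
have := prob_setID Q (mF _ _ IHF) (mF _ _ Fat).
have := ler_wpM2l del1 IHn; rewrite exprS; lra.
Qed.

(** [Y] is dominated by the series of its bounds at [s + (n + 1) T], each on the event of having
    missed [i0] at the [n] earlier grid times; integrating termwise leaves a polynomial times a
    geometric term. A general [Y] serves all three moments. *)
Lemma hitting_moment_le (Y : Omega -> \bar R) (a : R) :
  measurable_fun setT Y -> (forall w, (0 <= Y w)%E) -> 0 < a ->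
  (forall w u, 0 <= u -> Xi (X u w) -> (Y w <= (a * (1 + u) ^+ m)%:E)%E) ->
  forall s B, 0 <= s -> filtration P X s B ->
  (\int[Q]_(w in B) Y w <= (a * C * (1 + s) ^+ m)%:E * Q B)%E.
Proof.
move=> mY Y0 a0 Yle s B s0 FB.
have mF t E : filtration P X t E -> measurable E.
  by rewrite hF; exact: filtration_sub.
have mB := mF _ _ FB.
pose coef n : R := a * (1 + (s + n.+1%:R * T)) ^+ m.
have time0 n : 0 <= s + n.+1%:R * T by rewrite addr_ge0// mulr_ge0// ltW.
have coef_ge n : a <= coef n.
  by rewrite ler_peMr ?(ltW a0)// exprn_ege1// lerDl.
have coef0 n : 0 <= coef n by rewrite (le_trans (ltW a0)).
have mMiss n : measurable (missed s n).
  have FT : filtration P X s setT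
    by exact: (@measurableT _ (g_sigma_algebraType _)).
  by have := mF _ _ (missed_prob_le n s0 FT).1; rewrite setTI.
pose u n w : \bar R := (coef n * \1_(missed s n) w)%:E.
have u0 n w : (0 <= u n w)%E by rewrite lee_fin mulr_ge0.
(* If n is the first index at which i0 is met, term n dominates Y; if there is
   none, all the terms are at least a and the series is +oo. *)
have Yu w : (Y w <= \sum_(0 <= n <oo) u n w)%E.
  have [[n0 /eqP Xn0]|never] := pselect (exists n, X (s + n.+1%:R * T) w = i0).
    have ex : exists n, X (s + n.+1%:R * T) w == i0 by exists n0; rewrite Xn0.
    case: (ex_minnP ex) => n /eqP Xn minn.
    have Mw : missed s n w.
      by move=> k kn; apply/negP => /minn; rewrite leqNgt kn.
    have : (u n w <= \sum_(0 <= n <oo) u n w)%E.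
      apply: le_trans (nneseries_lim_ge n.+1 _) => //.
      by rewrite big_nat_recr//=; apply: leeDr; apply: sume_ge0 => *; exact: u0.
    apply: le_trans; rewrite /u indicE mem_set// mulr1.
    by apply: Yle => //; rewrite Xn.
  have uE n : u n w = (coef n)%:E.
    rewrite /u indicE mem_set ?mulr1// => k _; apply/eqP => Xk.
    by apply: never; exists k.
  have : (0 <= \sum_(0 <= n <oo) u n w)%E.
    by apply: nneseries_ge0 => *; exact: u0.
  case E : (\sum_(0 <= n <oo) u n w)%E => [r||]//.
    2: by move=> _; rewrite leey.
  rewrite lee_fin => r0; exfalso.
  pose k := (Num.truncn (r / a)).+1.
  have rk : r < k%:R * a.
    rewrite -ltr_pdivrMr//.
    by have /andP[] := @truncn_itv _ (r / a) (divr_ge0 r0 (ltW a0)).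
  have : ((k%:R * a)%:E <= r%:E)%E.
    rewrite -E; apply: le_trans (nneseries_lim_ge k _) => //.
    under eq_bigr do rewrite uE.
    rewrite sumEFin lee_fin mulr_natl -[k in leLHS]subn0 -sumr_const_nat.
    by apply: ler_sum => n _; exact: coef_ge.
  by rewrite lee_fin leNgt rk.
have mu_ n : measurable_fun B (u n).
  apply: measurable_funTS; apply/measurable_EFinP.
  by apply: measurable_funM => //; exact: measurable_indic.
have C_ge0 : 0 <= C by apply: le_trans (C0 0); rewrite big_nil.
have prB : Q B = (prob Q B)%:E by rewrite /prob fineK// fin_num_measure.
have prB0 : 0 <= prob Q B by exact: fine_ge0.
apply: (@le_trans _ _ (\int[Q]_(w in B) \sum_(0 <= n <oo) u n w)%E).
  apply: ge0_le_integral => //.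
  - exact: measurable_funTS.
  - by apply: ge0_emeasurable_sum => [n w _ _|n _]; [exact: u0|exact: mu_].
rewrite integral_nneseries//.
have intu n : (\int[Q]_(w in B) u n w =
  (coef n * prob Q (B `&` missed s n))%:E)%E.
  under eq_integral do rewrite /u EFinM.
  rewrite ge0_integralZl_EFin//; last first.
    by apply/measurable_EFinP; exact: measurable_indic.
  rewrite integral_indic// [missed s n `&` B]setIC [RHS]EFinM; congr (_ * _)%E.
  by rewrite /prob fineK// fin_num_measure//; exact: measurableI.
apply: lime_le.
  by apply: is_cvg_nneseries => n _ _; rewrite intu lee_fin mulr_ge0// fine_ge0.
apply: nearW => N; under eq_bigr do rewrite intu.
rewrite sumEFin prB -EFinM lee_fin.
apply: (@le_trans _ _ (\sum_(0 <= n < N) (a * (1 + s) ^+ m * prob Q B) *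
   ((1 + n.+1%:R * T) ^+ m * (1 - del) ^+ n))).
  apply: ler_sum => n _.
  have [_ le1] := missed_prob_le n s0 FB.
  apply: (@le_trans _ _ (coef n * ((1 - del) ^+ n * prob Q B))).
    by rewrite ler_wpM2l.
  have nT0 : 0 <= n.+1%:R * T by rewrite mulr_ge0// ltW.
  (* [1 + s + x <= (1 + s) (1 + x)] separates [s] from the series bounded by [C]. *)
  have le2 : (1 + (s + n.+1%:R * T)) ^+ m <=
    (1 + s) ^+ m * (1 + n.+1%:R * T) ^+ m.
    rewrite -exprMn; apply: lerXn2r; rewrite ?nnegrE.
    - lra.
    - by rewrite mulr_ge0//; lra.
    - by have := mulr_ge0 s0 nT0; lra.
  have -> : a * (1 + s) ^+ m * prob Q B *
        ((1 + n.+1%:R * T) ^+ m * (1 - del) ^+ n) =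
      a * ((1 + s) ^+ m * (1 + n.+1%:R * T) ^+ m) *
        ((1 - del) ^+ n * prob Q B).
    by ring.
  rewrite /coef ler_wpM2r//; first by rewrite mulr_ge0// exprn_ge0.
  by rewrite ler_wpM2l// ltW.
rewrite -mulr_sumr.
have -> : a * C * (1 + s) ^+ m * prob Q B =
  a * (1 + s) ^+ m * prob Q B * C by ring.
rewrite ler_wpM2l// !mulr_ge0 ?exprn_ge0 ?(ltW a0)//; lra.
Qed.

End hitting_moments.

(** * Bounds on conditional expectations *)

(** [Z] is the Radon-Nikodym derivative, with respect to the law of [phi], of the image under [phi]
    of the charge with density [Y]. With [phi] the identity into a coarser sigma-algebra, this is
    the conditional expectation. *)
Lemma factor_conditional_expectation (R : realType) (d d' : measure_display)
    (T : measurableType d) (T' : measurableType d') (Q : probability T R)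
    (phi : {mfun T >-> T'}) (Y : T -> \bar R) :
  Q.-integrable setT Y ->
  exists Z : T' -> \bar R, [/\ measurable_fun setT Z,
    Q.-integrable setT (Z \o phi) & forall B, measurable B ->
    (\int[Q]_(x in phi @^-1` B) Z (phi x) = \int[Q]_(x in phi @^-1` B) Y x)%E].
Proof.
move=> intY; have mphi : measurable_fun setT phi by [].
have mpB B : measurable B -> measurable (phi @^-1` B).
  by move=> mB; rewrite -[X in measurable X]setTI; exact: mphi.
pose nu := measure_function_pushforward__canonical__charge_Charge
  (charge_induced_charge__canonical__charge_Charge intY) mphi.
have dom : nu `<< distribution Q phi.
  apply/null_content_dominatesP => B mB QB0.
  rewrite /= /pushforward /= /induced_charge null_set_integral//.
  - exact: mpB.
  - by apply: measurable_funTS; exact: measurable_int intY.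
have intZ := Radon_Nikodym_integrable dom.
set Z := Radon_Nikodym _ _ in intZ.
have mZ : measurable_fun setT Z := measurable_int _ intZ.
have intZphi : Q.-integrable setT (Z \o phi).
  apply/integrableP; split; first exact: measurableT_comp.
  have /integrableP[_] := intZ; rewrite ge0_integral_pushforward//.
  by apply: measurableT_comp.
exists Z; split => // B mB.
transitivity (\int[distribution Q phi]_(x in B) Z x)%E.
  rewrite integral_pushforward//.
  exact: (integrableS measurableT (mpB _ mB) (@subsetT _ _) intZphi).
by rewrite -Radon_Nikodym_integral.
Qed.

(** Where a version [Z] exceeds [c], the integral of [Z - c] is at most 0 by hypothesis, so this
    event, which lies in the sub-sigma-algebra, is [Q]-null. *)
Lemma cond_exp_le_criterion (R : realType) (d : measure_display)
    (Omega : measurableType d) (P Q : probability Omega R)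
    (H : set_system Omega) (Y : Omega -> \bar R) (c : R) :
  <<s H >> `<=` @measurable d Omega -> measurable_fun setT Y ->
  (forall w, (0 <= Y w)%E) ->
  (forall B, <<s H >> B -> (\int[Q]_(w in B) Y w <= c%:E * Q B)%E) ->
  cond_exp_le P Q <<s H >> Y c.
Proof.
move=> mH mY Y0 leY.
have HT : <<s H >> setT by exact: (@measurableT _ (g_sigma_algebraType H)).
have intY : Q.-integrable setT Y.
  apply/integrableP; split => //.
  under eq_integral do rewrite gee0_abs//.
  by apply: le_lt_trans (leY _ HT) _; rewrite probability_setT mule1 ltry.
have mid : measurable_fun setT (idfun : Omega -> g_sigma_algebraType H).
  by move=> _ B mB; rewrite setTI; exact: mH.
pose phi : {mfun Omega >-> g_sigma_algebraType H} :=
  HB.pack idfun (isMeasurableFun.Build _ _ _ _ _ mid).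
have [Z [mZ intZ ZE]] := factor_conditional_expectation phi intY.
have {}ZE B : <<s H >> B ->
  (\int[Q]_(w in B) Z w = \int[Q]_(w in B) Y w)%E := ZE B.
have {}intZ : Q.-integrable (setT : set Omega) (Z : Omega -> \bar R) := intZ.
pose N := [set w | (c%:E < Z w)%E].
have HN : <<s H >> N.
  rewrite (_ : N = setT `&` Z @^-1` `]c%:E, +oo[%classic).
    by apply: mZ; [exact: measurableT|exact: emeasurable_itv].
  by rewrite setTI; apply/seteqP; split => w; rewrite /N /= in_itv/= andbT.
have mN := mH _ HN.
have intZN : Q.-integrable N (Z : Omega -> \bar R).
  exact: (integrableS measurableT mN (@subsetT _ _) intZ).
have intcN : Q.-integrable N (EFin \o (cst c : Omega -> R)).
  exact: finite_measure_integrable_cst.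
have QN0 : Q N = 0%E.
  have int0 : (\int[Q]_(w in N) (Z w - c%:E) = 0)%E.
    apply/eqP; rewrite eq_le; apply/andP; split; last first.
      by apply: integral_ge0 => w /ltW; rewrite sube_ge0// orbT.
    rewrite (integralB mN intZN intcN) (integral_cst Q mN c%:E) ZE//.
    by rewrite sube_le0; exact: leY.
  have : (\int[Q]_(w in N) `|Z w - c%:E| = 0)%E.
    by rewrite -[RHS]int0; apply: eq_integral => w /set_mem/ltW Nw;
      rewrite gee0_abs// sube_ge0// orbT.
  move=> /(ae_eq_integral_abs Q mN); case.
    by apply: emeasurable_funB => //; exact: (measurable_int _ intZN).
  move=> N0 [mN0 QN00 sub]; apply/eqP; rewrite -measure_le0 -QN00.
  apply: le_measure; rewrite ?inE// => w Nw; apply: sub => /= /(_ Nw) Zc.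
  by move: Nw; rewrite /N /= -sube_gt0 Zc ltxx.
(* Truncation at c changes the version on a Q-null set only, and makes the bound
   hold everywhere, in particular P-a.s., whatever the null sets of P. *)
pose Z' w := mine (Z w) c%:E.
have mZ' : measurable_fun (setT : set (g_sigma_algebraType H))
    (Z' : _ -> \bar R).
  by apply: measurable_mine => //; exact: measurable_cst.
exists Z'; split; last 2 first.
- by apply: aeW => w; rewrite /Z' ge_min lexx orbT.
- by apply: aeW => w; rewrite /Z' ge_min lexx orbT.
split => [V mV|B HB].
  by have := mZ' (@measurableT _ _) V mV; rewrite setTI.
have mB := mH _ HB; rewrite -ZE//; apply: ae_eq_integral => //.
- by apply: (measurable_funTS (D := B)); apply: (measurableT_comp mZ' mid).
- by apply: (measurable_funTS (D := B)); exact: (measurable_int _ intZ).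
exists N; split => // w /= /not_implyP[Bw ZZ']; rewrite /N /= ltNge.
by apply/negP => /min_idPl ZZ; apply: ZZ'; rewrite /Z' ZZ.
Qed.

(** * Measurability of the hitting time *)

Lemma measurable_hitting_time (R : realType) (I : countType)
    (d : measure_display) (Omega : measurableType d) (X : R -> Omega -> I)
    (Xi : set I) :
  pure_jump X -> (forall t, 0 <= t -> measurable (X t @^-1` Xi)) ->
  measurable_fun setT (hitting_time X Xi).
Proof.
move=> hX mX.
(* If the infimum is below [r], [Xi] is visited before [r], and by right-continuity also at a
   rational time before [r]. *)
have ltE r : [set w | (hitting_time X Xi w < r%:E)%E] =
    \bigcup_(q in [set q : rat | 0 <= (ratr q : R) < r]) (X (ratr q) @^-1` Xi).
  apply/seteqP; split => w /=.
    move=> /ereal_inf_lt[_ [t [t0 Xt] <-]]; rewrite lte_fin => tr.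
    have [e /= e0 He] := (hX w).1 t t0.
    have te : t < Num.min r (t + e) by rewrite lt_min tr ltrDl.
    have [q] := rat_in_itvoo te; rewrite in_itv/= => /andP[tq].
    rewrite lt_min => /andP[qr qe].
    exists q; first by apply/andP; split => //;
      exact: (ltW (le_lt_trans t0 tq)).
    rewrite /= (He (ratr q))//=.
    by rewrite ltr_norml; apply/andP; split; lra.
  move=> [q /andP[q0 qr] Xq].
  apply: le_lt_trans (_ : (_ <= (ratr q)%:E)%E) _; last by rewrite lte_fin.
  by apply: ereal_inf_lbound; exists (ratr q).
move=> mT; apply: (measurability _ (ErealGenInftyO.measurableE R)) => //.
move=> _ [_ [r ->] <-]; rewrite setTI.
rewrite (_ : _ @^-1` _ = [set w | (hitting_time X Xi w < r%:E)%E]); last first.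
  by apply/seteqP; split => w; rewrite /= in_itv.
rewrite ltE bigcup_mkcond; apply: bigcupT_measurable_rat => q.
by case: ifPn => // /set_mem/andP[q0 _]; exact: mX.
Qed.

Lemma hitting_time_ge0 (R : realType) (I : countType) (d : measure_display)
    (Omega : measurableType d) (X : R -> Omega -> I) (Xi : set I) w :
  (0 <= hitting_time X Xi w)%E.
Proof. by apply: le_ereal_inf_tmp => _ [t [t0 _] <-]; rewrite lee_fin. Qed.

Lemma hitting_time_le (R : realType) (I : countType) (d : measure_display)
    (Omega : measurableType d) (X : R -> Omega -> I) (Xi : set I) w u :
  0 <= u -> Xi (X u w) -> (hitting_time X Xi w <= u%:E)%E.
Proof. by move=> u0 Xu; apply: ereal_inf_lbound; exists u. Qed.

(** * Polynomial moment bounds, uniform over the family *)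

Theorem lemma6 (R : realType) (N : option nat)
    (d : measure_display) (Omega : measurableType d)
    (P : probability Omega R) (X : R -> Omega -> state N)
    (A : state N -> state N -> R) (p : R -> state N -> state N -> R)
    (pi : state N -> R) (gamma : R) (Xi : set (state N))
    (xi : {RV P >-> R}) (g : R -> state N -> R) (k b : R)
    (hF : @measurable d Omega = filtration_oo P X)
    (hX : pure_jump X)
    (hA : bounded_rate_matrix A)
    (hp : transition_function A p)
    (hmarkov : markov_chain P X p)
    (herg : uniformly_ergodic p pi)
    (hgamma : 0 < gamma)
    (hXi : Xi !=set0)
    (hpiXi : (0 < \esum_(i in Xi) (pi i)%:E)%E)
    (hk : 0 < k) (hb : 0 < b)
    (hg : forall t i, 0 <= t -> `|g t i| <= k * (1 + t `^ b))
    (hxi : forall w t, hitting_time X Xi w = t%:E -> xi w = g t (X t w)) :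
  exists (K Kt : R -> R) (beta betat : R),
    [/\ nondecreasing_ge1 K, nondecreasing_ge1 Kt, 0 < beta, 0 < betat
      & forall Q : probability Omega R, Qfamily P X A gamma Q ->
        forall t, 0 <= t ->
        [/\ cond_exp_le P Q (filtration P X t) (fun w => `|xi w|%:E) (K t),
            cond_exp_le P Q (filtration P X t)
              (fun w => ((1 + hitting_time X Xi w) `^ (1 + beta))%E) (K t)
          & cond_exp_le P Q (filtration P X t)
              (fun w => (at_time K (hitting_time X Xi w) `^ (1 + betat))%E)
              (Kt t)]].
Proof.
have [i0 [t0 [e0 [Xi0 t00 e00 pe]]]] :=
  uniformly_ergodic_minorized hp herg hpiXi.
have [T [del' [T0 del'0 hitQ]]] :=
  uniform_hitting_prob hF hX hA hp hgamma t00 e00 pe.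
pose del := Num.min del' 1.
have del01 : 0 < del <= 1 by rewrite lt_min del'0 ltr01 ge_min lexx orbT.
have del1 : 0 <= 1 - del by rewrite subr_ge0; case/andP: del01.
(* [m] is at least [b], for [xi], and at least 2, for the square of [1 + tau]. *)
pose m := (Num.truncn b).+2.
have [C1 C1ge C1P] := sum_poly_geometric_bounded m T0 del01.
have [C2 C2ge C2P] := sum_poly_geometric_bounded (m * 2) T0 del01.
(* The factor [2 k] comes from [k (1 + t^b) <= 2 k (1 + t)^m]; the maximum with 1 serves the second
   bound and gives [K >= 1]. *)
pose c := Num.max 1 (2 * k) * C1.
have max1 : 1 <= Num.max 1 (2 * k) by rewrite le_max lexx.
have c1 : 1 <= c by rewrite /c; nra.
have c0 : 0 < c by lra.
pose K (t : R) := c * (1 + t) ^+ m.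
(* The square of [K] has degree [2 m], hence the constant [C2]. *)
pose Kt (t : R) := c ^+ 2 * C2 * (1 + t) ^+ (m * 2).
have poly_incr (a : R) n : 1 <= a ->
  nondecreasing_ge1 (fun t => a * (1 + t) ^+ n).
  move=> a1; split => [s t s0 st|t tt0].
    rewrite ler_wpM2l//; first by lra.
    by apply: lerXn2r; rewrite ?nnegrE; lra.
  have : 1 <= (1 + t) ^+ n by rewrite exprn_ege1// lerDl.
  nra.
have mXi t : 0 <= t -> measurable (X t @^-1` Xi).
  move=> tt0; rewrite hF; apply: (@filtration_sub _ _ _ _ _ _ t).
  exact: filtration_state.
have mtau : measurable_fun setT (hitting_time X Xi) :=
  measurable_hitting_time hX mXi.
have m1tau : measurable_fun setT (fun w => 1 + hitting_time X Xi w)%E.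
  exact: emeasurable_funD.
(* Both sides are [+oo] on paths which never meet [Xi]; the right-hand side is a measurable function
   of the hitting time. *)
have KE w : (at_time K (hitting_time X Xi w) =
    c%:E * (1 + hitting_time X Xi w) `^ m%:R)%E.
  have := hitting_time_ge0 X Xi w; case: (hitting_time X Xi w) => [t||] //.
    by rewrite lee_fin /= => tt0; rewrite powR_mulrn// addr_ge0.
  by move=> _; rewrite addey// poweRyr ?pnatr_eq0// gt0_muley.
have tau_fin w u : 0 <= u -> Xi (X u w) ->
    exists t, [/\ hitting_time X Xi w = t%:E, 0 <= t & t <= u].
  move=> u0 Xu; have := hitting_time_ge0 X Xi w.
  have := @hitting_time_le _ _ _ _ X Xi w u u0 Xu.
  by case: (hitting_time X Xi w) => [t||]//; rewrite !lee_fin; exists t.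
(* With [beta = betat = 1] both exponents are 2, so that integer powers suffice. *)
exists K, Kt, 1, 1; split => //.
- exact: poly_incr.
- by apply: poly_incr; have : 1 <= c ^+ 2 by [rewrite exprn_ege1]; nra.
move=> Q QQ t tt0.
have hit s B : 0 <= s -> filtration P X s B ->
    del * prob Q B <= prob Q (B `&` at_state X (s + T) i0).
  move=> s0 FB; apply: le_trans (hitQ Q QQ s B s0 FB).
  by rewrite ler_wpM2r ?fine_ge0// ge_min lexx.
have mF : filtration P X t `<=` @measurable d Omega.
  by rewrite hF; exact: filtration_sub.
have criterion (Y : Omega -> \bar R) (a C M : R) n :
    (forall N,
      \sum_(0 <= n' < N) (1 + n'.+1%:R * T) ^+ n * (1 - del) ^+ n' <= C) ->
    measurable_fun setT Y -> (forall w, 0 <= Y w)%E -> 0 < a ->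
    (forall w u, 0 <= u -> Xi (X u w) -> (Y w <= (a * (1 + u) ^+ n)%:E)%E) ->
    a * C * (1 + t) ^+ n <= M -> cond_exp_le P Q (filtration P X t) Y M.
  move=> CP mY Y0 a0 Ya aM; apply: cond_exp_le_criterion => // B FB.
  have := hitting_moment_le hF Xi0 T0 del1 hit CP mY Y0 a0 Ya tt0 FB.
  move/le_trans; apply.
  by rewrite lee_wpmul2r// lee_fin.
have t1m : 0 <= (1 + t) ^+ m by rewrite exprn_ge0// addr_ge0.
have powle (n' n : nat) (x : R) : (n' <= n)%N -> 0 <= x ->
  (1 + x) ^+ n' <= (1 + x) ^+ n.
  by move=> nn x0; rewrite ler_weXn2l// lerDl.
split.
- apply: (criterion _ (2 * k) C1 _ m) => //.
  + by apply/measurable_EFinP; exact: measurableT_comp.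
  + by rewrite mulr_gt0.
  + move=> w u u0 Xu; have [s [tauE s0 su]] := tau_fin w u u0 Xu.
    rewrite lee_fin (hxi _ _ tauE) (le_trans (hg _ _ s0))//.
    rewrite -mulrA mulrCA ler_wpM2l ?(ltW hk)//.
    have : s `^ b <= (1 + u) ^+ m.
      rewrite -powR_mulrn ?addr_ge0//.
      apply: (@le_trans _ _ ((1 + u) `^ b)).
        by apply: ge0_ler_powR; rewrite ?nnegrE ?(ltW hb)//; lra.
      rewrite ler_powR ?lerDl//; have /andP[_ /ltW bm] := truncn_itv (ltW hb).
      by apply: le_trans bm _; rewrite ler_nat.
    have : 1 <= (1 + u) ^+ m by rewrite exprn_ege1// lerDl.
    lra.
  + rewrite /K ler_wpM2r// /c ler_wpM2r//; first by lra.
    by rewrite le_max lexx orbT.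
- apply: (criterion _ 1 C1 _ m) => //.
  + by apply: (measurableT_comp (measurable_poweR _)) m1tau.
  + by move=> w; exact: poweR_ge0.
  + move=> w u u0 Xu; have [s [-> s0 su]] := tau_fin w u u0 Xu.
    rewrite -EFinD poweR_EFin lee_fin mul1r (_ : 1 + 1 = 2%:R)//.
    rewrite powR_mulrn ?addr_ge0//; apply: (@le_trans _ _ ((1 + u) ^+ 2)).
      by apply: lerXn2r; rewrite ?nnegrE; lra.
    exact: powle.
  + by rewrite /K ler_wpM2r// mul1r /c; nra.
- apply: (criterion _ (c ^+ 2) C2 _ (m * 2)%N) => //.
  + apply: (measurableT_comp (measurable_poweR _)).
    rewrite (_ : (fun w => _) = fun w =>
      (c%:E * (1 + hitting_time X Xi w) `^ m%:R)%E); last exact/funext.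
    apply: measurable_funeM.
    exact: (measurableT_comp (measurable_poweR _)) m1tau.
  + by move=> w; exact: poweR_ge0.
  + by rewrite exprn_gt0.
  + move=> w u u0 Xu; have [s [-> s0 su]] := tau_fin w u u0 Xu.
    rewrite /= lee_fin (_ : 1 + 1 = 2%:R)//.
    have [Kinc K1] := poly_incr c m c1.
    rewrite powR_mulrn; last by apply: le_trans (K1 _ s0).
    rewrite exprM -exprMn; apply: lerXn2r; rewrite ?nnegrE.
    * by apply: le_trans (K1 _ s0).
    * by apply: le_trans (K1 _ u0).
    * exact: Kinc.
Qed.
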